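(* Let $I=(i_1,\dots,i_r)$ with $1\le i_1<\dots<i_r\le n$, and let $I'=(i'_1,\dots,i'_s)$, $1\le i'_1<\dots<i'_s\le n$, be its complement in $\{1,\dots,n\}$, $n=r+s$. Let $N=\mathrm{intc}(I)$ be the column intertwining order of $I$ in $\{1,\dots,n\}$. Then in $\mathcal O_q(M_n(k))$ $$[r+1\dots n,\,I']\,[1\dots r,\,I]=\sum_{i=0}^{N}(-1)^i(q^{-1}-q)^i\sum_{(R,R')\in C_i^I}[1\dots r,\,R]\,[r+1\dots n,\,R'],$$ where $C_i^I$ are the lists (with repetitions counted) defined in the context.
   Context: Let $k$ be a field, $q$ an indeterminate, $k_q=k[q,q^{-1}]$. $\mathcal O_q(M_n(k))$ is the $k_q$-algebra generated by $x_{ij}$, $1\le i,j\le n$, with relations: $x_{ij}x_{ik}=q^{-1}x_{ik}x_{ij}$ and $x_{ji}x_{ki}=q^{-1}x_{ki}x_{ji}$ for $j<k$; $x_{ij}x_{kl}=x_{kl}x_{ij}$ if $i<k,\ j>l$ or $i>k,\ j<l$; $x_{ij}x_{kl}-x_{kl}x_{ij}=(q^{-1}-q)x_{kj}x_{il}$ if $i<k,\ j<l$. Quantum minors: for increasing tuples $A=(a_1<\dots<a_p)$, $B=(b_1<\dots<b_p)$, $[A,B]=\sum_{\sigma\in S_p}(-q)^{-l(\sigma)}x_{a_1b_{\sigma(1)}}\cdots x_{a_pb_{\sigma(p)}}$, with $l(\sigma)$ the number of inversions. For a tuple $S$ of distinct integers, $S_{ord}$ is its increasing rearrangement and $l(S)$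 is its number of inversions; for tuples $A,B$ of distinct entries not necessarily increasing, $[A,B]:=(-q)^{-l(A)-l(B)}[A_{ord},B_{ord}]$. Standard column tower: let $J=(j_1<\dots<j_r)$ in $\{1,\dots,n\}$, $J\ne(n-r+1,\dots,n)$. Put $j_{r+1}=n+1$ and let $p$ be the largest index in $\{1,\dots,r\}$ with $j_{p+1}-j_p>1$; the standard column transposition of $J$ is $\sigma_J=(j_p,\,j_p+1)$. Applying successively the standard transpositions one gets the standard column tower $I=I_N<I_{N-1}<\dots<I_0=(n-r+1,\dots,n)$, with $I_{s-1}=\sigma_s(I_s)$, $\sigma_s=\sigma_{I_s}$; its length $N=\mathrm{intc}(I)$ is the column intertwining order of $I$. The lists $C_i^{I_s}$ (finite lists, with multiplicity, of pairs $(R,R')$ of tuples of distinct, not necessarily increasing, integers): $C_0^{I_0}$ consists of the single pair $(I_0,I_0')$, where $I_0'$ is the increasing complement of $I_0$; $C_i^{I_s}$ is empty if $i<0$ or $i>s$; for $1\le s\le N$ and $0\le i\le s$, $C_i^{I_s}$ is the concatenation of $C_{i-1}^{I_{s-1}}$ with the members of $\phi_{i-1}^{I_{s-1}}$ removed, and of $\sigma_s(C_i^{I_{s-1}})$. Here $\sigma_s$ acts by applying the transposition to every entry of $R$ and $R'$ (with no reordering), and, if $\sigma_s=(z,z+1)$, $\phi_{i-1}^{I_{s-1}}$ is the sublist of $C_{i-1}^{I_{s-1}}$ of those $(R,R')$ for which $z$ appears before $z+1$ in the concatenated tuple $(R,R')$. Finally $C_i^I:=C_i^{I_N}$. *)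

(* Defs.v *)
From HB Require Import structures.
From mathcomp Require Import all_boot all_order all_algebra all_fingroup.
From mathcomp Require Import generic_quotient ring_quotient fraction.
From mathcomp.classical Require boolp.
From mathcomp.multinomials Require Import monalg.

Set Implicit Arguments.
Unset Strict Implicit.
Unset Printing Implicit Defensive.

Import GRing.Theory.
Local Open Scope ring_scope.

(* k[q, q^-1], realized inside the fraction field k(X) of k[X] as the subring  *)
(* of the fractions p / X^m; the indeterminate q is X.                         *)
Section Laurent.
Variable k : fieldType.

Local Notation "x %:F" := (@FracField.tofrac {poly k} x).

Definition laurent_pred (f : {fraction {poly k}}) : bool :=
  boolp.asbool (exists (p : {poly k}) (m : nat), f = p%:F / 'X%:F ^+ m).

Lemma fracX_neq0 m : 'X%:F ^+ m != 0.
Proof. by rewrite expf_neq0 // tofrac_eq0 polyX_eq0. Qed.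

Lemma laurent_subring_closed : subring_closed laurent_pred.
Proof.
split.
- by apply/boolp.asboolP; exists 1, 0; rewrite expr0 divr1 tofrac1.
- move=> f g /boolp.asboolP[p [m ->]] /boolp.asboolP[p' [m' ->]].
  apply/boolp.asboolP; exists (p * 'X^m' - p' * 'X^m), (m + m')%N.
  rewrite exprD tofracB !tofracM !tofracXn mulrBl; congr (_ - _).
    by rewrite invfM mulrACA mulfV ?mulr1 // fracX_neq0.
  by rewrite invfM [_^-1 / _]mulrC mulrACA mulfV ?mulr1 // fracX_neq0.
- move=> f g /boolp.asboolP[p [m ->]] /boolp.asboolP[p' [m' ->]].
  apply/boolp.asboolP; exists (p * p'), (m + m')%N.
  by rewrite exprD tofracM invfM mulrACA.
Qed.

HB.instance Definition _ :=
  GRing.isSubringClosed.Build {fraction {poly k}} laurent_pred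
    laurent_subring_closed.

Record laurent : predArgType :=
  Laurent { laurent_val : {fraction {poly k}}; _ : laurent_pred laurent_val }.

HB.instance Definition _ := [isSub for laurent_val].
HB.instance Definition _ := [Choice of laurent by <:].
HB.instance Definition _ := [SubChoice_isSubComNzRing of laurent by <:].

Definition laurent_unit (f : laurent) : bool :=
  (val f != 0) && laurent_pred (val f)^-1.

Definition laurent_inv (f : laurent) : laurent :=
  if laurent_unit f then insubd f (val f)^-1 else f.

Lemma laurent_mulVx : {in laurent_unit, left_inverse 1 laurent_inv *%R}.
Proof.
move=> f fU; apply: val_inj; rewrite /laurent_inv ifT // rmorphM rmorph1 /=.
by case/andP: fU => f0 fV; rewrite val_insubd fV mulVf.
Qed.

Lemma laurent_unitPl (f g : laurent) : g * f = 1 -> laurent_unit f.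
Proof.
move/(congr1 val); rewrite rmorphM rmorph1 /= => gf1.
have f0 : val f != 0.
  by apply/eqP=> f0; move/eqP: gf1; rewrite f0 mulr0 eq_sym oner_eq0.
rewrite /laurent_unit f0 /=.
by rewrite -[(val f)^-1]mul1r -gf1 mulfK //; exact: valP.
Qed.

Lemma laurent_inv_out : {in [predC laurent_unit], laurent_inv =1 id}.
Proof.
by move=> f /negbTE fU; rewrite /laurent_inv; rewrite [laurent_unit f]fU.
Qed.

HB.instance Definition _ :=
  GRing.ComNzRing_hasMulInverse.Build laurent
    laurent_mulVx laurent_unitPl laurent_inv_out.

Lemma laurent_predX : laurent_pred 'X%:F.
Proof. by apply/boolp.asboolP; exists 'X, 0; rewrite expr0 divr1. Qed.

Definition qvar : laurent := Laurent laurent_predX.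

Lemma qvar_unit : qvar \is a GRing.unit.
Proof.
rewrite unfold_in /=; apply/andP; split.
  by rewrite -[val _]expr1 fracX_neq0.
by apply/boolp.asboolP; exists 1, 1; rewrite tofrac1 mul1r expr1.
Qed.

End Laurent.

Arguments qvar {k}.

(* The quantum matrix algebra: the free algebra on the x_ij modulo the         *)
(* two-sided ideal generated by the defining relations. Here and below the     *)
(* indices 1, ..., n are shifted to the elements 0, ..., n - 1 of 'I_n.        *)
Section QuantumMatrices.
Variables (kq : comUnitRingType) (q : kq) (n : nat).

Local Notation freealg := {malg kq[{fmonom ('I_n * 'I_n)%type}]}.

Definition freegen (i j : 'I_n) : freealg := << fmu (i, j) >>.
Local Notation X := freegen.

Inductive qmx_rel : freealg -> freealg -> Prop :=
| QmxRow (i j l : 'I_n) of (j < l)%N :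
    qmx_rel (X i j * X i l) (q^-1 *: (X i l * X i j))
| QmxCol (i j l : 'I_n) of (j < l)%N :
    qmx_rel (X j i * X l i) (q^-1 *: (X l i * X j i))
| QmxComm (i j m l : 'I_n) of (i < m)%N && (l < j)%N || (m < i)%N && (j < l)%N :
    qmx_rel (X i j * X m l) (X m l * X i j)
| QmxCross (i j m l : 'I_n) of (i < m)%N & (j < l)%N :
    qmx_rel (X i j * X m l - X m l * X i j) ((q^-1 - q) *: (X m j * X i l)).

Inductive qmx_ideal : freealg -> Prop :=
| QmxGen a b of qmx_rel a b : qmx_ideal (a - b)
| Qmx0 : qmx_ideal 0
| QmxAdd a b of qmx_ideal a & qmx_ideal b : qmx_ideal (a + b)
| QmxMull c a of qmx_ideal a : qmx_ideal (c * a)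
| QmxMulr c a of qmx_ideal a : qmx_ideal (a * c).

Definition qmx_idealb (a : freealg) : bool := boolp.asbool (qmx_ideal a).

Lemma qmx_idealP a : reflect (qmx_ideal a) (qmx_idealb a).
Proof. exact: boolp.asboolP. Qed.

Lemma qmx_ideal_zmod_closed : zmod_closed qmx_idealb.
Proof.
split; first exact/qmx_idealP/Qmx0.
move=> a b /qmx_idealP aI /qmx_idealP bI; apply/qmx_idealP.
by apply: QmxAdd => //; rewrite -mulN1r; apply: QmxMull.
Qed.

HB.instance Definition _ :=
  GRing.isZmodClosed.Build freealg qmx_idealb qmx_ideal_zmod_closed.

Definition qmx_idealz : zmodClosed freealg :=
  GRing.ZmodClosed.clone freealg qmx_idealb _.

Definition qmx : Type := Quotient.quot qmx_idealz.

HB.instance Definition _ := GRing.Zmodule.on qmx.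
HB.instance Definition _ := EqQuotient.on qmx.

Local Open Scope quotient_scope.

Definition qmx_pi (a : freealg) : qmx := \pi_qmx a.

Lemma qmx_piP a b : reflect (qmx_pi a = qmx_pi b) (qmx_idealb (a - b)).
Proof.
rewrite -[qmx_idealb _]/(a - b \in qmx_idealz).
rewrite Quotient.idealrBE; exact: eqP.
Qed.

Lemma qmx_piE (u : qmx) : qmx_pi (repr u) = u.
Proof. exact: reprK. Qed.

Lemma qmx_piD : {morph qmx_pi : a b / a + b}.
Proof. by move=> a b; rewrite /qmx_pi; exact: (Quotient.pi_add _ a b). Qed.

Definition qmx_one : qmx := qmx_pi 1.
Definition qmx_mul (u v : qmx) : qmx := qmx_pi (repr u * repr v).
Definition qmx_scale (c : kq) (u : qmx) : qmx := qmx_pi (c *: repr u).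

Lemma repr_qmx_pi a : qmx_ideal (repr (qmx_pi a) - a).
Proof. by apply/qmx_idealP/qmx_piP; rewrite qmx_piE. Qed.

Lemma qmx_piM a b : qmx_mul (qmx_pi a) (qmx_pi b) = qmx_pi (a * b).
Proof.
apply/qmx_piP/qmx_idealP.
set a' := repr _; set b' := repr _.
have -> : a' * b' - a * b = (a' - a) * b' + a * (b' - b).
  by rewrite mulrBl mulrBr addrA subrK.
by apply: QmxAdd; [apply: QmxMulr|apply: QmxMull]; apply: repr_qmx_pi.
Qed.

Lemma qmx_piZ c a : qmx_scale c (qmx_pi a) = qmx_pi (c *: a).
Proof.
apply/qmx_piP/qmx_idealP; rewrite -scalerBr -mul_malgC.
exact/QmxMull/repr_qmx_pi.
Qed.

Lemma qmx_mulA : associative qmx_mul.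
Proof.
move=> u v w; rewrite -(qmx_piE u) -(qmx_piE v) -(qmx_piE w).
by rewrite !qmx_piM mulrA.
Qed.

Lemma qmx_mul1 : left_id qmx_one qmx_mul.
Proof. by move=> u; rewrite -(qmx_piE u) qmx_piM mul1r. Qed.

Lemma qmx_mulr1 : right_id qmx_one qmx_mul.
Proof. by move=> u; rewrite -(qmx_piE u) qmx_piM mulr1. Qed.

Lemma qmx_mulDl : left_distributive qmx_mul +%R.
Proof.
move=> u v w; rewrite -(qmx_piE u) -(qmx_piE v) -(qmx_piE w).
by rewrite -qmx_piD !qmx_piM -qmx_piD mulrDl.
Qed.

Lemma qmx_mulDr : right_distributive qmx_mul +%R.
Proof.
move=> u v w; rewrite -(qmx_piE u) -(qmx_piE v) -(qmx_piE w).
by rewrite -qmx_piD !qmx_piM -qmx_piD mulrDr.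
Qed.

(* The constant term is a ring morphism that kills the relations. *)
Lemma qmx_ideal_const a : qmx_ideal a -> mcoeff mone a = 0.
Proof.
have X0 i j : mcoeff mone (X i j) = 0.
  rewrite mcoeffU1; case: eqP => // /(congr1 (fun m : {fmonom _} => size m)).
  by rewrite fm1 fmU.
have cM : {morph (mcoeff mone : freealg -> kq) : b c / b * c}.
  by case: (mcoeff1g_is_multiplicative {fmonom ('I_n * 'I_n)%type} kq).
have XX0 i j m l : mcoeff mone (X i j * X m l) = 0.
  by rewrite cM X0 mul0r.
have cB b c : mcoeff mone b = 0 -> mcoeff mone c = 0 ->
    mcoeff mone (b - c : freealg) = 0.
  by move=> b0 c0; rewrite mcoeffB b0 c0 subrr.
have cZ d c : mcoeff mone c = 0 -> mcoeff mone (d *: c : freealg) = 0.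
  by move=> c0; rewrite mcoeffZ c0 mulr0.
elim=> [_ _ []||b c _ b0 _ c0|b c _ c0|b c _ c0].
- by move=> i j l _; apply: (cB _ _ (XX0 _ _ _ _)); apply/cZ/XX0.
- by move=> i j l _; apply: (cB _ _ (XX0 _ _ _ _)); apply/cZ/XX0.
- by move=> i j m l _; apply: (cB _ _ (XX0 _ _ _ _)); apply: XX0.
- move=> i j m l _ _; apply: (cB); last exact/cZ/XX0.
  by apply: (cB _ _ (XX0 _ _ _ _)); apply: XX0.
- exact: mcoeff0.
- by rewrite mcoeffD b0 c0 addr0.
- by rewrite cM c0 mulr0.
- by rewrite cM c0 mul0r.
Qed.

Lemma qmx_nonzero1 : qmx_one != 0.
Proof.
have <- : qmx_pi 0 = 0 by apply: (addrI (qmx_pi 0)); rewrite -qmx_piD !addr0.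
apply/eqP=> /qmx_piP/qmx_idealP; rewrite subr0 => /qmx_ideal_const/eqP.
by rewrite mcoeff1 eqxx oner_eq0.
Qed.

HB.instance Definition _ := GRing.Zmodule_isNzRing.Build qmx
  qmx_mulA qmx_mul1 qmx_mulr1 qmx_mulDl qmx_mulDr qmx_nonzero1.

Lemma qmx_scaleA c d u : qmx_scale c (qmx_scale d u) = qmx_scale (c * d) u.
Proof. by rewrite -(qmx_piE u) !qmx_piZ scalerA. Qed.

Lemma qmx_scale1 : left_id 1 qmx_scale.
Proof. by move=> u; rewrite -(qmx_piE u) qmx_piZ scale1r. Qed.

Lemma qmx_scaleDr : right_distributive qmx_scale +%R.
Proof.
move=> c u v; rewrite -(qmx_piE u) -(qmx_piE v).
by rewrite -qmx_piD !qmx_piZ -qmx_piD scalerDr.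
Qed.

Lemma qmx_scaleDl u : {morph qmx_scale^~ u : c d / c + d}.
Proof.
by move=> c d; rewrite -(qmx_piE u) !qmx_piZ -qmx_piD scalerDl.
Qed.

HB.instance Definition _ := GRing.Zmodule_isLmodule.Build kq qmx
  qmx_scaleA qmx_scale1 qmx_scaleDr qmx_scaleDl.

Lemma qmx_scaleAl c (u v : qmx) : c *: (u * v) = (c *: u) * v.
Proof.
rewrite -(qmx_piE u) -(qmx_piE v) /GRing.scale /GRing.mul /=.
by rewrite !(qmx_piM, qmx_piZ) -scalerAl.
Qed.

HB.instance Definition _ := GRing.Lmodule_isLalgebra.Build kq qmx qmx_scaleAl.

Lemma malgC_central (c : kq) (a : freealg) : a * c%:MP = c%:MP * a.
Proof.
rewrite [a]monalgE mulr_suml mulr_sumr; apply: eq_bigr => m _.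
by rewrite !malgM_def !fgmulUU mulrC mulm1 mul1m.
Qed.

Lemma qmx_scaleAr c (u v : qmx) : c *: (u * v) = u * (c *: v).
Proof.
rewrite -(qmx_piE u) -(qmx_piE v) /GRing.scale /GRing.mul /=.
by rewrite !(qmx_piM, qmx_piZ) -!mul_malgC !mulrA malgC_central.
Qed.

HB.instance Definition _ := GRing.Lalgebra_isAlgebra.Build kq qmx
  qmx_scaleAr.

Definition qgen (i j : 'I_n) : qmx := qmx_pi (freegen i j).

Lemma qmx_relP a b : qmx_rel a b -> qmx_pi a = qmx_pi b.
Proof. by move=> ab; apply/qmx_piP/qmx_idealP/QmxGen. Qed.

End QuantumMatrices.

Arguments qgen {kq} q {n}.

Section QuantumMinors.
Variables (kq : comUnitRingType) (q : kq) (n : nat).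

Definition inversions p (f : 'I_p -> nat) : nat :=
  #|[set ij : 'I_p * 'I_p | (ij.1 < ij.2)%N && (f ij.2 < f ij.1)%N]|.

Definition tinv p (S : p.-tuple 'I_n) : nat := inversions (fun i => tnth S i).

Definition tord p (S : p.-tuple 'I_n) : p.-tuple 'I_n :=
  [tuple of sort (fun i j : 'I_n => (i <= j)%N) S].

Definition qminor_inc p (A B : p.-tuple 'I_n) : qmx q n :=
  \sum_(s : 'S_p) (- q) ^- inversions (fun i => s i) *:
    \prod_(i < p) qgen q (tnth A i) (tnth B (s i)).

Definition qminor p (A B : p.-tuple 'I_n) : qmx q n :=
  (- q) ^- (tinv A + tinv B) *: qminor_inc (tord A) (tord B).

Definition increasing p (S : p.-tuple 'I_n) : bool :=
  sorted (fun i j : 'I_n => (i < j)%N) S.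

Lemma increasing_tord p (S : p.-tuple 'I_n) : increasing S -> tord S = S.
Proof.
move=> incS; apply: val_inj; apply: sorted_sort.
  by move=> ? ? ?; apply: leq_trans.
by apply: sub_sorted incS => i j /ltnW.
Qed.

Lemma increasing_tinv p (S : p.-tuple 'I_n) : increasing S -> tinv S = 0%N.
Proof.
move=> incS; apply: eq_card0 => -[i j]; rewrite inE /=.
apply/negP=> /andP[ij]; apply/negP; rewrite -leqNgt ltnW //.
have d := tnth S i; rewrite !(tnth_nth d).
have tr : transitive (fun i j : 'I_n => (i < j)%N).
  by move=> ? ? ?; apply: ltn_trans.
by apply: (sorted_ltn_nth tr d incS); rewrite ?inE ?size_tuple.
Qed.

(* On increasing tuples the extended minor is the basic one. *)
Lemma qminor_incE p (A B : p.-tuple 'I_n) :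
  increasing A -> increasing B -> qminor A B = qminor_inc A B.
Proof.
move=> iA iB; rewrite /qminor !increasing_tord // !increasing_tinv //.
by rewrite addn0 expr0 invr1 scale1r.
Qed.

End QuantumMinors.

Arguments qminor {kq} q {n p}.

Section Tower.
Variables r s : nat.
Local Notation n := (r + s)%N.
Implicit Type J : r.-tuple 'I_n.

(* (1, ..., r) and (r + 1, ..., n) *)
Definition first_idx : r.-tuple 'I_n := [tuple lshift s i | i < r].
Definition last_idx : s.-tuple 'I_n := [tuple rshift r i | i < s].

(* I_0 = (n - r + 1, ..., n) = (s + 1, ..., s + r) and I_0' = (1, ..., s) *)
Definition top_cols : r.-tuple 'I_n :=
  [tuple cast_ord (addnC s r) (rshift s i) | i < r].
Definition top_compl : s.-tuple 'I_n :=
  [tuple cast_ord (addnC s r) (lshift r i) | i < s].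

(* The default value n of nth is the (shifted) convention j_{r+1} = n + 1. *)
Definition gap_at J (p : 'I_r) : bool :=
  (1 < nth n (map val J) p.+1 - nth n (map val J) p)%N.

Definition std_idx J : option 'I_r :=
  [pick p | gap_at J p && [forall p', gap_at J p' ==> (p' <= p)%N]].

(* The entry z = j_p moved by the standard transposition (z, z + 1); there is  *)
(* none when J is the top one. Since z + 1 <= n, ordS z is z + 1.              *)
Definition std_entry J : option 'I_n := omap (tnth J) (std_idx J).

Definition std_perm J : {perm 'I_n} :=
  if std_entry J is Some z then tperm z (ordS z) else 1%g.

Definition permt (t : {perm 'I_n}) p (S : p.-tuple 'I_n) : p.-tuple 'I_n :=
  [tuple of map t S].

Definition std_step J : r.-tuple 'I_n := permt (std_perm J) J.

(* The least number of standard transpositions leading from J to the top one.  *)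
Definition intc J : nat := findex std_step J top_cols.

(* tower I t is the term I_t of the tower of I *)
Definition tower J (t : nat) : r.-tuple 'I_n := iter (intc J - t) std_step J.

Definition before (z z' : 'I_n) (RR : r.-tuple 'I_n * s.-tuple 'I_n) : bool :=
  (index z (RR.1 ++ RR.2) < index z' (RR.1 ++ RR.2))%N.

Definition in_phi J (RR : r.-tuple 'I_n * s.-tuple 'I_n) : bool :=
  if std_entry J is Some z then before z (ordS z) RR else false.

(* Clist_rec I t i is the list C_i^{I_t}, for I_t as in tower I; that it is    *)
(* empty for i > t results from the recursion, see Clist_rec_out.              *)
Fixpoint Clist_rec J (t i : nat) : seq (r.-tuple 'I_n * s.-tuple 'I_n) :=
  match t with
  | 0 => if i is 0 then [:: (top_cols, top_compl)] else [::]
  | t'.+1 =>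
      let Jt := tower J t'.+1 in
      (if i is i'.+1 then [seq RR <- Clist_rec J t' i' | ~~ in_phi Jt RR]
       else [::])
      ++ [seq (permt (std_perm Jt) RR.1, permt (std_perm Jt) RR.2)
         | RR <- Clist_rec J t' i]
  end.

Definition Clist J (i : nat) := Clist_rec J (intc J) i.

Lemma Clist_rec_out J t i : (t < i)%N -> Clist_rec J t i = [::].
Proof.
by elim: t i => [|t IHt] [|i] //= lti; rewrite !IHt //; apply: leq_trans lti.
Qed.

Lemma increasing_ltn J (i j : 'I_r) :
  increasing J -> (i < j)%N -> (tnth J i < tnth J j)%N.
Proof.
move=> incJ ij; have d := tnth J i; rewrite !(tnth_nth d).
have tr : transitive (fun i j : 'I_n => (i < j)%N).
  by move=> ? ? ?; apply: ltn_trans.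
by apply: (sorted_ltn_nth tr d incJ); rewrite ?inE ?size_tuple.
Qed.

Lemma ltn_increasing J :
  (forall i j : 'I_r, (i < j)%N -> (tnth J i < tnth J j)%N) -> increasing J.
Proof.
move=> mJ; rewrite /increasing; case EJ: (tval J) => [//|d t]; rewrite -EJ.
apply/(sortedP d) => i; rewrite size_tuple => lti.
have := mJ (Ordinal (ltnW lti)) (Ordinal lti) (ltnSn i).
by rewrite !(tnth_nth d).
Qed.

Lemma nth_val J (p : 'I_r) : nth n (map val J) p = tnth J p :> nat.
Proof. by rewrite (nth_map (tnth J p)) ?size_tuple // -tnth_nth. Qed.

Lemma nth_val_out J p : (r <= p)%N -> nth n (map val J) p = n.
Proof. by move=> rp; rewrite nth_default // size_map size_tuple. Qed.

Lemma nth_val_max J p : (nth n (map val J) p <= n)%N.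
Proof.
case: (ltnP p r) => [ltp|/nth_val_out-> //].
by rewrite (nth_val J (Ordinal ltp)) ltnW.
Qed.

Lemma nth_val_ltn J (i : 'I_r) j : increasing J -> (i < j)%N ->
  (tnth J i < nth n (map val J) j)%N.
Proof.
move=> incJ ij; case: (ltnP j r) => [ltj|]; last by move/nth_val_out->.
by rewrite (nth_val J (Ordinal ltj)) increasing_ltn.
Qed.

Lemma nth_val_leq J i j : increasing J -> (i <= j)%N ->
  (nth n (map val J) i <= nth n (map val J) j)%N.
Proof.
move=> incJ; rewrite leq_eqVlt => /predU1P[->//|ij].
case: (ltnP i r) => [lti|ri].
  by rewrite (nth_val J (Ordinal lti)) ltnW // nth_val_ltn.
by rewrite !nth_val_out // (leq_trans ri) // ltnW.
Qed.

Lemma std_entryP J : increasing J -> J != top_cols ->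
  exists2 p : 'I_r, std_entry J = Some (tnth J p) & gap_at J p.
Proof.
move=> incJ Jtop; rewrite /std_entry /std_idx.
case: pickP => [p /andP[gp _]|nomax]; first by exists p.
case/eqP: Jtop.
have [/existsP[p0 g0]|] := boolP [exists p, gap_at J p].
  case: (arg_maxnP (fun p : 'I_r => p : nat) g0) => p gp maxp.
  have /= := nomax p; rewrite gp => /negP[]; apply/forallP => p'.
  by apply/implyP => /maxp.
rewrite negb_exists => /forallP nogap.
have ext m : (m <= r)%N -> nth n (map val J) (r - m) = (n - m)%N.
  elim: m => [|m IHm] ltm; first by rewrite !subn0 nth_val_out.
  have rm : (r - m.+1 < r)%N by rewrite ltn_subrL (leq_trans _ ltm).
  have Erm : (r - m.+1).+1 = (r - m)%N by rewrite -subSn.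
  have lt1 : (nth n (map val J) (r - m.+1) < n - m)%N.
    rewrite -(IHm (ltnW ltm)) -Erm (nth_val J (Ordinal rm)).
    exact: (@nth_val_ltn J (Ordinal rm)).
  have := nogap (Ordinal rm).
  rewrite /gap_at /= Erm (IHm (ltnW ltm)) -leqNgt leq_subLR addn1 => le1.
  by rewrite [RHS]subnS (anti_leq (introT andP (conj le1 lt1))).
apply: eq_from_tnth => p; apply: val_inj; rewrite tnth_mktuple /=.
have := ext (r - p)%N (leq_subr _ _).
rewrite subKn 1?ltnW // nth_val => ->.
by rewrite addnC -addnBA ?leq_subr // subKn // ltnW.
Qed.

Lemma std_stepE J (p : 'I_r) : increasing J ->
    std_entry J = Some (tnth J p) -> gap_at J p ->
  forall i, tnth (std_step J) i = (tnth J i + (i == p))%N :> nat.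
Proof.
move=> incJ Ep; rewrite /gap_at nth_val ltn_subRL addn1 => gp i.
have ltz : ((tnth J p).+1 < n)%N.
  by apply: (leq_trans gp); apply: nth_val_max.
rewrite tnth_map /std_perm Ep.
have [->|ip] := eqVneq i p; first by rewrite tpermL /= modn_small // addn1.
rewrite addn0 tpermD //; apply/eqP => E.
  case: (ltngtP i p) => [lip|lpi|/val_inj eip]; last by rewrite eip eqxx in ip.
    by have := increasing_ltn incJ lip; rewrite E ltnn.
  by have := increasing_ltn incJ lpi; rewrite E ltnn.
have {}E : (tnth J p).+1 = tnth J i by rewrite -E /= modn_small.
case: (ltngtP i p) => [lip|lpi|/val_inj eip]; last by rewrite eip eqxx in ip.
  by have := ltnW (increasing_ltn incJ lip); rewrite -E ltnn.
by have := leq_trans gp (nth_val_leq incJ lpi); rewrite nth_val -E ltnn.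
Qed.

Lemma std_step_increasing J : increasing J -> J != top_cols ->
  increasing (std_step J).
Proof.
move=> incJ Jtop; have [p Ep gp] := std_entryP incJ Jtop.
apply: ltn_increasing => i j ij; rewrite !(std_stepE incJ Ep gp).
have [eip|_] := eqVneq i p; last first.
  by rewrite addn0 ltn_addr // increasing_ltn.
move: gp; rewrite /gap_at nth_val ltn_subRL addn1 addn1 eip => gp.
apply: (leq_trans gp); apply: (leq_trans _ (leq_addr _ _)); rewrite -eip.
by apply: (leq_trans (nth_val_leq incJ ij)); rewrite nth_val.
Qed.

(* Standard transpositions lead from any increasing tuple to the top one, so   *)
(* that findex in intc is never a default value.                               *)
Lemma iter_intc J : increasing J -> iter (intc J) std_step J = top_cols.
Proof.
move=> incJ; apply: iter_findex.
have [m] := ubnP (r * n - \sum_(i < r) tnth J i)%N.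
elim: m J incJ => // m IHm J incJ ltm.
have [->|Jtop] := eqVneq J top_cols; first exact: connect0.
apply: (connect_trans (fconnect1 _ _)).
apply: IHm; first exact: std_step_increasing.
have [p Ep gp] := std_entryP incJ Jtop.
have sumE : (\sum_(i < r) tnth (std_step J) i = (\sum_(i < r) tnth J i).+1)%N.
  rewrite (eq_bigr _ (fun i _ => std_stepE incJ Ep gp i)) big_split /=.
  have -> : (\sum_(i < r) (i == p) = 1)%N.
    by rewrite (bigD1 p) //= eqxx big1 ?addn0 // => i /negbTE->.
  by rewrite addn1.
have : (\sum_(i < r) tnth (std_step J) i <= r * n)%N.
  rewrite -[r in (r * _)%N]card_ord -sum_nat_const leq_sum // => i _.
  exact: ltnW.
rewrite sumE => ltS; rewrite -ltnS; apply: leq_trans ltm; rewrite ltnS.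
exact: ltn_sub2l.
Qed.

End Tower.

(* Main.v *)
Require Import Defs.
From HB Require Import structures.
From mathcomp Require Import all_boot all_order all_algebra all_fingroup.
From mathcomp Require Import generic_quotient zify.
From mathcomp.multinomials Require Import monalg.

Set Implicit Arguments.
Unset Strict Implicit.
Unset Printing Implicit Defensive.

Import GRing.Theory.
Local Open Scope ring_scope.

(** The recursion for the lists C_i^{I_t} is an action of Hecke generators. Write
    T_z, for z' = z + 1, for the operator on pairs of tuples given by
      T_z(w) = sigma(w)                   if z appears before z' in w,
      T_z(w) = sigma(w) - (q^-1 - q) w    otherwise,
    with sigma = (z, z'). If F(I_t) is the right-hand side of the theorem for I_t,
    then F(I_{t+1}) = T_z F(I_t). So it is enough to realize T_z by a linear
    endomorphism of the whole algebra O_q(M_n): the left-hand side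
    G(I) = [r+1..n, I'][1..r, I] is itself a product of two minors, in which z
    comes before z' when I = I_t, so that T_z G(I_t) = G(I_{t+1}), and
    G(I_0) = F(I_0) because all the generators involved commute.

    The endomorphism is q^-1 (F_z E_z - 1), where E_z and F_z are the skew
    derivations that replace the column z' by z and z by z', that is, the action of
    the Chevalley generators of U_q(gl_n) by column operations. Each D of the two
    satisfies D(uv) = D(u) K(v) + u D(v) for a diagonal automorphism K; it exists
    because u |-> [[K(u), 0], [D(u), u]], as a map from the generators to 2 x 2
    matrices, respects the relations. *)

(** * Algebra morphisms out of O_q(M_n) *)

Section QuantumMatrixLift.
Variables (kq : comUnitRingType) (q : kq) (n : nat) (B : nzRingType).
Variables (f : {rmorphism kq -> B}) (X : 'I_n -> 'I_n -> B).
Hypothesis commX : forall c i j, GRing.comm (f c) (X i j).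
Hypothesis rowX : forall i j l : 'I_n, (j < l)%N ->
  X i j * X i l = f q^-1 * (X i l * X i j).
Hypothesis colX : forall i j l : 'I_n, (j < l)%N ->
  X j i * X l i = f q^-1 * (X l i * X j i).
Hypothesis antiX : forall i j m l : 'I_n, (i < m)%N -> (l < j)%N ->
  X i j * X m l = X m l * X i j.
Hypothesis crossX : forall i j m l : 'I_n, (i < m)%N -> (j < l)%N ->
  X i j * X m l - X m l * X i j = f (q^-1 - q) * (X m j * X i l).

Definition word_eval (w : {fmonom ('I_n * 'I_n)%type}) : B :=
  \prod_(u <- (w : seq _)) X u.1 u.2.

Lemma word_eval_mmorphism : mmorphism word_eval.
Proof.
split; last by rewrite /word_eval fm1 big_nil.
by move=> v w; rewrite /word_eval fmM big_cat.
Qed.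

HB.instance Definition _ :=
  monalg.isMultiplicative.Build {fmonom ('I_n * 'I_n)%type} B word_eval
    word_eval_mmorphism.

Local Notation freelift := (mmap f word_eval).

Lemma freelift_gen i j : freelift (freegen kq i j) = X i j.
Proof.
by rewrite /freegen mmapU [X in X * _]rmorph1 mul1r /= /word_eval fmU big_seq1.
Qed.

Lemma comm_word_eval c w : GRing.comm (f c) (word_eval w).
Proof.
rewrite /word_eval; elim: (w : seq _) => [|u l IHl].
  by rewrite big_nil; exact: commr1.
by rewrite big_cons; apply: commrM.
Qed.

Lemma freelift_multiplicative : multiplicative freelift.
Proof. by apply: commr_mmap_is_multiplicative => g m m'; exact: comm_word_eval. Qed.

Lemma freeliftM a b : freelift (a * b) = freelift a * freelift b.
Proof. by case: freelift_multiplicative. Qed.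

Lemma freelift_rel a b : qmx_rel q a b -> freelift a = freelift b.
Proof.
have genM i j m l :
    freelift (freegen kq i j * freegen kq m l) = X i j * X m l.
  by rewrite freeliftM !freelift_gen.
case=> [i j l jl|i j l jl|i j m l iml|i j m l im jl].
- by rewrite genM mmapZ genM rowX.
- by rewrite genM mmapZ genM colX.
- apply: (etrans (genM i j m l)).
  apply: (etrans _ (esym (genM m l i j))).
  by case/orP: iml => /andP[h1 h2]; [|symmetry]; apply: antiX.
- rewrite mmapZ; apply: (etrans (mmapB _ _)).
  apply: (etrans (congr2 (fun b c => b - c) (genM i j m l) (genM m l i j))).
  by rewrite crossX //; congr (_ * _); apply: (esym (genM m j i l)).
Qed.

Lemma freelift_ideal a : qmx_ideal q a -> freelift a = 0.
Proof.
elim=> [b c bc||b c _ b0 _ c0|c b _ b0|c b _ b0].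
- by rewrite mmapB (freelift_rel bc) subrr.
- exact: mmap0.
- by rewrite mmapD b0 c0 addr0.
- by rewrite freeliftM b0 mulr0.
- by rewrite freeliftM b0 mul0r.
Qed.

(** The scalars act through [f], whose image only has to commute with the [X i j]; this admits 2 x 2
    matrices over a noncommutative algebra as target. By [qmx_lift_pi] the choice of representative
    does not matter. *)
Definition qmx_lift (u : qmx q n) : B := freelift (repr u).

Lemma qmx_lift_pi a : qmx_lift (qmx_pi q a) = freelift a.
Proof.
by apply/eqP; rewrite -subr_eq0 -mmapB freelift_ideal //; exact: repr_qmx_pi.
Qed.

Lemma qmx_liftD u v : qmx_lift (u + v) = qmx_lift u + qmx_lift v.
Proof.
by rewrite -(qmx_piE u) -(qmx_piE v) -qmx_piD !qmx_lift_pi mmapD.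
Qed.

Lemma qmx_liftM u v : qmx_lift (u * v) = qmx_lift u * qmx_lift v.
Proof.
rewrite -(qmx_piE u) -(qmx_piE v).
have -> : qmx_pi q (repr u) * qmx_pi q (repr v) = qmx_pi q (repr u * repr v).
  exact: qmx_piM.
by rewrite !qmx_lift_pi freeliftM.
Qed.

Lemma qmx_lift1 : qmx_lift 1 = 1.
Proof.
have -> : 1 = qmx_pi q 1 :> qmx q n by [].
by rewrite qmx_lift_pi mmap1.
Qed.

Lemma qmx_liftZ c u : qmx_lift (c *: u) = f c * qmx_lift u.
Proof.
rewrite -(qmx_piE u).
have -> : c *: qmx_pi q (repr u) = qmx_pi q (c *: repr u) by exact: qmx_piZ.
by rewrite !qmx_lift_pi mmapZ.
Qed.

Lemma qmx_lift_gen i j : qmx_lift (qgen q i j) = X i j.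
Proof. by rewrite qmx_lift_pi freelift_gen. Qed.

End QuantumMatrixLift.

(** Every class is a linear combination of words, and a word is built by adding one letter at a time
    on the left. *)
Lemma qmx_ind (kq : comUnitRingType) (q : kq) (n : nat) (P : qmx q n -> Prop) :
  P 0 -> P 1 -> (forall u v, P u -> P v -> P (u + v)) ->
  (forall c u, P u -> P (c *: u)) ->
  (forall i j u, P u -> P (qgen q i j * u)) -> forall u, P u.
Proof.
move=> P0 P1 PD PZ PM u; rewrite -(qmx_piE u) [repr u]monalgE.
have piZ c a : qmx_pi q (c *: a) = c *: qmx_pi q a :> qmx q n.
  by symmetry; exact: qmx_piZ.
have pi0 : qmx_pi q 0 = 0 :> qmx q n.
  by apply: (addrI (qmx_pi q 0)); rewrite -qmx_piD !addr0.
elim/big_rec: _ => [|w a _ Pa]; first by rewrite pi0.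
rewrite qmx_piD; apply: PD => //.
have -> : << (repr u)@_w *g w >> = (repr u)@_w *: << w >>
    :> {malg kq[{fmonom ('I_n * 'I_n)%type}]}.
  by rewrite -mul_malgC malgM_def fgmulUU mulr1 mul1m.
rewrite piZ; apply: PZ; case: w => w; elim: w => [|[i j] w IHw].
  have -> : FMonom [::] = mone :> {fmonom ('I_n * 'I_n)%type}.
    by apply: val_inj; rewrite /= fm1.
  exact: P1.
have -> : << FMonom ((i, j) :: w) >> = freegen kq i j * << FMonom w >>.
  rewrite malgM_def fgmulUU mulr1; congr << _ >>.
  by apply: val_inj; rewrite /= fmM fmU.
have -> : qmx_pi q (freegen kq i j * << FMonom w >>) =
    qgen q i j * qmx_pi q << FMonom w >> by symmetry; exact: qmx_piM.
exact: PM.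
Qed.

(** * Skew derivations of O_q(M_n) *)

Section LowerTriangular.
Variable A : nzRingType.

Definition ltmx2 (u v w : A) : 'M[A]_2 :=
  \matrix_(i, j) if (i : 'I_2) == ord0 then (if (j : 'I_2) == ord0 then u else 0)
                 else (if j == ord0 then v else w).

(** For matrices with rows (K(u), 0) and (D(u), u), the lower left entry of the product is the
    twisted Leibniz rule D(u u') = D(u) K(u') + u D(u'). *)
Lemma ltmx2M u v w u' v' w' :
  ltmx2 u v w * ltmx2 u' v' w' = ltmx2 (u * u') (v * u' + w * v') (w * w').
Proof.
apply/matrixP=> i j; rewrite !mxE !big_ord_recl big_ord0 addr0 !mxE /=.
by case: eqP; case: eqP; rewrite ?(mul0r, mulr0, add0r, addr0).
Qed.

Lemma ltmx2D u v w u' v' w' :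
  ltmx2 u v w + ltmx2 u' v' w' = ltmx2 (u + u') (v + v') (w + w').
Proof.
by apply/matrixP=> i j; rewrite !mxE; case: eqP; case: eqP; rewrite ?addr0.
Qed.

Lemma ltmx2B u v w u' v' w' :
  ltmx2 u v w - ltmx2 u' v' w' = ltmx2 (u - u') (v - v') (w - w').
Proof.
by apply/matrixP=> i j; rewrite !mxE; case: eqP; case: eqP; rewrite ?subr0.
Qed.

Lemma ltmx2_scalar a : a%:M = ltmx2 a 0 a.
Proof.
apply/matrixP=> i j; rewrite !mxE.
by case: i j => [[|[|i]] ?] // [[|[|j]] ?].
Qed.

End LowerTriangular.

(** * The 2 x 2 matrices attached to the generators satisfy the defining relations *)

Section SkewDerivation.
Variables (kq : comUnitRingType) (q : kq) (n : nat) (A : algType kq).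
Variable x : 'I_n -> 'I_n -> A.
Hypothesis uq : q \is a GRing.unit.
Hypothesis rowx : forall i j l : 'I_n, (j < l)%N ->
  x i j * x i l = q^-1 *: (x i l * x i j).
Hypothesis colx : forall i j l : 'I_n, (j < l)%N ->
  x j i * x l i = q^-1 *: (x l i * x j i).
Hypothesis antix : forall i j m l : 'I_n, (i < m)%N -> (l < j)%N ->
  x i j * x m l = x m l * x i j.
Hypothesis crossx : forall i j m l : 'I_n, (i < m)%N -> (j < l)%N ->
  x i j * x m l - x m l * x i j = (q^-1 - q) *: (x m j * x i l).
Variables z zz : 'I_n.
Hypothesis zzE : zz = z.+1 :> nat.

(** The weight of column [j]: the eigenvalue of the Cartan element of the simple root at [z]. *)
Definition kappa (j : 'I_n) : kq :=
  if j == z then q else if j == zz then q^-1 else 1.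

Variables a b : 'I_n.
Hypothesis ab : (a, b) = (z, zz) \/ (a, b) = (zz, z).

(** One definition serves both Chevalley generators: E_z for (a, b) = (zz, z) and F_z for (a, b) =
    (z, zz). *)
Definition dgen (i j : 'I_n) : A := if j == a then x i b else 0.

Definition skew_mx (i j : 'I_n) : 'M[A]_2 :=
  ltmx2 (kappa j *: x i j) (dgen i j) (x i j).

Definition scal2 : {rmorphism kq -> 'M[A]_2} := @scalar_mx A 2 \o in_alg A.

Lemma scal2E c u v w : scal2 c * ltmx2 u v w = ltmx2 (c *: u) (c *: v) (c *: w).
Proof.
by rewrite /scal2 /= ltmx2_scalar ltmx2M mul0r add0r -!scalerAl !mul1r.
Qed.

Lemma comm_skew_mx c i j : GRing.comm (scal2 c) (skew_mx i j).
Proof.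
rewrite /GRing.comm scal2E /scal2 /= ltmx2_scalar ltmx2M mulr0 addr0.
by rewrite -!scalerAr !mulr1.
Qed.

(** No index lies between [z] and [zz]. Hence replacing column [a] by [b] next to a third column
    leaves the type of the relation unchanged. *)
Lemma ltn_adj (l : 'I_n) : l != z -> l != zz ->
  (((a < l)%N = (b < l)%N) * ((l < a)%N = (l < b)%N))%type.
Proof.
rewrite -!val_eqE /= => lz lzz.
by case: ab => -[-> ->]; split; lia.
Qed.

Lemma other_adj (l : 'I_n) : l != a -> l != b -> l != z /\ l != zz.
Proof. by case: ab => -[-> ->]. Qed.

Lemma kappa_other (l : 'I_n) : l != a -> l != b -> kappa l = 1.
Proof.
move=> la lb; have [/negbTE lz /negbTE lzz] := other_adj la lb.
by rewrite /kappa lz lzz.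
Qed.

Lemma kappaz : kappa z = q. Proof. by rewrite /kappa eqxx. Qed.

Lemma kappazz : kappa zz = q^-1.
Proof. by rewrite /kappa eqxx ifN // -val_eqE /= zzE; lia. Qed.

(** The delicate case is that of the columns [a] and [b]: both generators land in column [b], and
    [kappa b] accounts for the factor q^-1 of the relation. *)
Lemma skew_row i (j l : 'I_n) : (j < l)%N ->
  skew_mx i j * skew_mx i l = scal2 q^-1 * (skew_mx i l * skew_mx i j).
Proof.
move=> jl; rewrite !ltmx2M scal2E; congr ltmx2; last exact: rowx.
  rewrite -!(scalerAl, scalerAr) rowx // !scalerA; congr (_ *: _).
  by rewrite mulrC mulrA mulrAC.
rewrite /dgen; have [ja|ja] := eqVneq j a; have [la|la] := eqVneq l a.
- by move: jl; rewrite ja la ltnn.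
- rewrite mulr0 addr0 mul0r add0r -scalerAr; have [lb|lb] := eqVneq l b.
    case: ab => -[az bz]; last by move: jl; rewrite ja lb az bz; lia.
    by rewrite lb bz kappazz.
  have [lz lzz] := other_adj la lb.
  by rewrite kappa_other // scale1r rowx // -(ltn_adj lz lzz) -ja.
- rewrite mulr0 addr0 mul0r add0r -scalerAr; have [jb|jb] := eqVneq j b.
    case: ab => -[az bz]; first by move: jl; rewrite la jb az bz; lia.
    by rewrite jb bz kappaz scalerA mulVr // scale1r.
  have [jz jzz] := other_adj ja jb.
  by rewrite kappa_other // scale1r rowx // -(ltn_adj jz jzz) -la.
- by rewrite !(mul0r, mulr0, addr0) scaler0.
Qed.

Lemma ltn_zzz : (z < zz)%N. Proof. by rewrite zzE. Qed.

(** In column [a] both Leibniz terms survive, each mixing the columns [z] and [zz]. The cross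
    relation reorders one of them, and its extra term combines with the factors [kappa]. *)
Lemma skew_col i (j l : 'I_n) : (j < l)%N ->
  skew_mx j i * skew_mx l i = scal2 q^-1 * (skew_mx l i * skew_mx j i).
Proof.
move=> jl; rewrite !ltmx2M scal2E; congr ltmx2; last exact: colx.
  rewrite -!(scalerAl, scalerAr) colx // !scalerA; congr (_ *: _).
  by rewrite mulrC mulrA.
rewrite /dgen; have [ia|ia] := eqVneq i a; last first.
  by rewrite !(mul0r, mulr0, addr0) scaler0.
have crossE : x j z * x l zz = x l zz * x j z + (q^-1 - q) *: (x l z * x j zz).
  by rewrite -(crossx jl ltn_zzz) addrC subrK.
have antiE : x j zz * x l z = x l z * x j zz by apply: antix => //; exact: ltn_zzz.
case: ab => -[az bz]; rewrite ia az bz ?kappaz ?kappazz -!scalerAr.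
  rewrite crossE antiE scalerDr scalerA mulVr // scale1r.
  by rewrite addrCA -scalerDl; congr (_ + _ *: _); rewrite addrC subrK.
rewrite crossE antiE !scalerDr !scalerA.
rewrite -addrA addrC; congr (_ + _).
rewrite -[X in _ + X]scale1r -scalerDl; congr (_ *: _).
by rewrite mulrBr mulVr ?subrK.
Qed.

(** For the columns [a] and [b], both generators land in column [b]: the commutation turns into the
    column relation, whose factor [kappa b] cancels. *)
Lemma skew_anti (i j m l : 'I_n) : (i < m)%N -> (l < j)%N ->
  skew_mx i j * skew_mx m l = skew_mx m l * skew_mx i j.
Proof.
move=> im lj; rewrite !ltmx2M; congr ltmx2; last exact: antix.
  by rewrite -!(scalerAl, scalerAr) antix // !scalerA mulrC.
rewrite /dgen; have [ja|ja] := eqVneq j a; have [la|la] := eqVneq l a.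
- by move: lj; rewrite ja la ltnn.
- rewrite mulr0 addr0 mul0r add0r -scalerAr; have [lb|lb] := eqVneq l b.
    case: ab => -[az bz]; first by move: lj; rewrite ja lb az bz; lia.
    by rewrite lb bz kappaz colx // scalerA mulrV // scale1r.
  have [lz lzz] := other_adj la lb.
  by rewrite kappa_other // scale1r antix // -(ltn_adj lz lzz) -ja.
- rewrite mulr0 addr0 mul0r add0r -scalerAr; have [jb|jb] := eqVneq j b.
    case: ab => -[az bz]; last by move: lj; rewrite la jb az bz; lia.
    by rewrite jb bz kappazz colx.
  have [jz jzz] := other_adj ja jb.
  by rewrite kappa_other // scale1r antix // -(ltn_adj jz jzz) -la.
- by rewrite !(mul0r, mulr0, addr0).
Qed.

(** Again the columns [a] and [b] merge into one, and the column relation reduces the claim to an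
    identity between scalars. *)
Lemma skew_cross (i j m l : 'I_n) : (i < m)%N -> (j < l)%N ->
  skew_mx i j * skew_mx m l - skew_mx m l * skew_mx i j =
  scal2 (q^-1 - q) * (skew_mx m j * skew_mx i l).
Proof.
move=> im jl; rewrite !ltmx2M ltmx2B scal2E; congr ltmx2; last exact: crossx.
  rewrite -!(scalerAl, scalerAr) !scalerA [kappa l * _]mulrC -scalerBr.
  by rewrite crossx // scalerA [in LHS]mulrC mulrA.
rewrite /dgen; have [ja|ja] := eqVneq j a; have [la|la] := eqVneq l a.
- by move: jl; rewrite ja la ltnn.
- rewrite !mulr0 !addr0 mul0r add0r -!scalerAr; have [lb|lb] := eqVneq l b.
    case: ab => -[az bz]; last by move: jl; rewrite ja lb az bz; lia.
    rewrite lb bz kappazz colx // -{2}[_ * _]scale1r !scalerA -scalerBl.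
    by congr (_ *: _); rewrite mulrBl mulrV.
  have [lz lzz] := other_adj la lb.
  by rewrite kappa_other // !scale1r crossx // -(ltn_adj lz lzz) -ja.
- rewrite !mul0r !mulr0 !add0r !addr0 -!scalerAr; have [jb|jb] := eqVneq j b.
    case: ab => -[az bz]; first by move: jl; rewrite la jb az bz; lia.
    by rewrite jb bz kappaz colx // scalerBl.
  have [jz jzz] := other_adj ja jb.
  by rewrite kappa_other // scale1r crossx // -(ltn_adj jz jzz) -la.
- by rewrite !(mul0r, mulr0, addr0) subr0 scaler0.
Qed.

End SkewDerivation.

(** * The defining relations between the generators of O_q(M_n) *)

Section Relations.
Variables (kq : comUnitRingType) (q : kq) (n : nat).
Implicit Types i j m l : 'I_n.

Local Notation x := (@qgen kq q n).
Local Notation X := (@freegen kq n).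

Lemma qgen_pi2 i j m l : x i j * x m l = qmx_pi q (X i j * X m l).
Proof. exact: qmx_piM. Qed.

Lemma qgen_piZ2 c i j m l :
  c *: (x i j * x m l) = qmx_pi q (c *: (X i j * X m l)).
Proof. exact: (etrans (congr1 _ (qgen_pi2 i j m l)) (qmx_piZ q c _)). Qed.

Lemma qgen_row i j l : (j < l)%N ->
  x i j * x i l = q^-1 *: (x i l * x i j).
Proof.
move=> jl; apply: (etrans (qgen_pi2 i j i l)).
exact: (etrans (qmx_relP (QmxRow q i jl)) (esym (qgen_piZ2 _ _ _ _ _))).
Qed.

Lemma qgen_col i j l : (j < l)%N ->
  x j i * x l i = q^-1 *: (x l i * x j i).
Proof.
move=> jl; apply: (etrans (qgen_pi2 j i l i)).
exact: (etrans (qmx_relP (QmxCol q i jl)) (esym (qgen_piZ2 _ _ _ _ _))).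
Qed.

Lemma qgen_anti i j m l : (i < m)%N -> (l < j)%N ->
  x i j * x m l = x m l * x i j.
Proof.
move=> im lj; have h : (i < m)%N && (l < j)%N || (m < i)%N && (j < l)%N.
  by rewrite im lj.
apply: (etrans (qgen_pi2 i j m l)).
exact: (etrans (qmx_relP (QmxComm q h)) (esym (qgen_pi2 _ _ _ _))).
Qed.

Lemma qgen_cross i j m l : (i < m)%N -> (j < l)%N ->
  x i j * x m l - x m l * x i j = (q^-1 - q) *: (x m j * x i l).
Proof.
move=> im jl; apply: (etrans _ (esym (qgen_piZ2 _ _ _ _ _))).
apply: (etrans _ (qmx_relP (QmxCross q im jl))).
apply: (etrans (congr2 (fun u v => u - v) (qgen_pi2 i j m l)
                       (qgen_pi2 m l i j))).
apply: (canLR (addrK _)).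
by apply: (etrans _ (qmx_piD _ _ _)); rewrite subrK.
Qed.
End Relations.

(** * Existence of the skew derivations *)

Section QuantumSkewDerivation.
Variables (kq : comUnitRingType) (q : kq) (n : nat).
Hypothesis uq : q \is a GRing.unit.
Variables z zz : 'I_n.
Hypothesis zzE : zz = z.+1 :> nat.
Variables a b : 'I_n.
Hypothesis ab : (a, b) = (z, zz) \/ (a, b) = (zz, z).

Let A : algType kq := qmx q n.
Let x : 'I_n -> 'I_n -> A := @qgen kq q n.
Let X : 'I_n -> 'I_n -> 'M[A]_2 := skew_mx q x z zz a b.

Fact skew_comm c i j : GRing.comm (scal2 A c) (X i j).
Proof. exact: comm_skew_mx. Qed.

Fact skew_rowX (i j l : 'I_n) : (j < l)%N ->
  X i j * X i l = scal2 A q^-1 * (X i l * X i j).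
Proof. exact: (skew_row uq (@qgen_row kq q n) zzE ab). Qed.

Fact skew_colX (i j l : 'I_n) : (j < l)%N ->
  X j i * X l i = scal2 A q^-1 * (X l i * X j i).
Proof.
exact: (skew_col uq (@qgen_col kq q n) (@qgen_anti kq q n)
                 (@qgen_cross kq q n) zzE ab).
Qed.

Fact skew_antiX (i j m l : 'I_n) : (i < m)%N -> (l < j)%N ->
  X i j * X m l = X m l * X i j.
Proof. exact: (skew_anti uq (@qgen_col kq q n) (@qgen_anti kq q n) zzE ab). Qed.

Fact skew_crossX (i j m l : 'I_n) : (i < m)%N -> (j < l)%N ->
  X i j * X m l - X m l * X i j = scal2 A (q^-1 - q) * (X m j * X i l).
Proof. exact: (skew_cross uq (@qgen_col kq q n) (@qgen_cross kq q n) zzE ab). Qed.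

Let lift : A -> 'M[A]_2 := qmx_lift (scal2 A) X.

Fact skew_liftD u v : lift (u + v) = lift u + lift v.
Proof. exact: (qmx_liftD skew_comm skew_rowX skew_colX skew_antiX skew_crossX). Qed.

Fact skew_liftM u v : lift (u * v) = lift u * lift v.
Proof. exact: (qmx_liftM skew_comm skew_rowX skew_colX skew_antiX skew_crossX). Qed.

Fact skew_lift1 : lift 1 = 1.
Proof. exact: (qmx_lift1 skew_comm skew_rowX skew_colX skew_antiX skew_crossX). Qed.

Fact skew_liftZ c u : lift (c *: u) = scal2 A c * lift u.
Proof. exact: (qmx_liftZ skew_comm skew_rowX skew_colX skew_antiX skew_crossX). Qed.

Fact skew_lift_gen i j : lift (x i j) = X i j.
Proof. exact: (qmx_lift_gen skew_comm skew_rowX skew_colX skew_antiX skew_crossX). Qed.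

(** This triangular shape, which holds on generators and is stable under the operations, is what
    makes the corner entries a morphism and a skew derivation. *)
Fact skew_lift_ltmx u : lift u = ltmx2 (lift u ord0 ord0) (lift u ord_max ord0) u.
Proof.
have ltE p v w : lift p = ltmx2 v w p ->
    lift p = ltmx2 (lift p ord0 ord0) (lift p ord_max ord0) p.
  by move=> E; rewrite {1}E E !mxE.
(* The induction may leave the first column unspecified: [ltE] reads it off afterwards. *)
suff [v [w]] : exists v w, lift u = ltmx2 v w u by exact: ltE.
elim/qmx_ind: u =>
  [||u1 u2 [v1 [w1 E1]] [v2 [w2 E2]]|c u1 [v1 [w1 E1]]|i j u1 [v1 [w1 E1]]].
- exists 0, 0; apply: (addrI (lift 0)); rewrite -skew_liftD addr0.
  by apply/matrixP => i j; rewrite !mxE; do 2!case: eqP; rewrite addr0.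
- exists 1, 0; rewrite skew_lift1; exact: ltmx2_scalar.
- by exists (v1 + v2), (w1 + w2); rewrite skew_liftD E1 E2 ltmx2D.
- by exists (c *: v1), (c *: w1); rewrite skew_liftZ E1 scal2E.
- by do 2!eexists; rewrite skew_liftM skew_lift_gen E1 ltmx2M.
Qed.

Lemma qmx_skew_derivation : exists K D : A -> A,
  [/\ [/\ forall u v, K (u + v) = K u + K v, forall c u, K (c *: u) = c *: K u,
        K 1 = 1, forall u v, K (u * v) = K u * K v &
        forall i j, K (x i j) = kappa q z zz j *: x i j]
    & [/\ forall u v, D (u + v) = D u + D v, forall c u, D (c *: u) = c *: D u,
        forall u v, D (u * v) = D u * K v + u * D v &
        forall i j, D (x i j) = if j == a then x i b else 0]].
Proof.
(* In dimension 2, [ord_max] is the second row: K is the upper left entry and D the lower left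
   one. *)
exists (fun u => lift u ord0 ord0), (fun u => lift u ord_max ord0).
have E := skew_lift_ltmx.
split; split.
- by move=> u v; rewrite skew_liftD mxE.
- by move=> c u; rewrite skew_liftZ E scal2E !mxE.
- by rewrite skew_lift1 mxE.
- by move=> u v; rewrite skew_liftM (E u) (E v) ltmx2M !mxE.
- by move=> i j; rewrite skew_lift_gen mxE.
- by move=> u v; rewrite skew_liftD mxE.
- by move=> c u; rewrite skew_liftZ E scal2E !mxE.
- by move=> u v; rewrite skew_liftM (E u) (E v) ltmx2M !mxE.
- by move=> i j; rewrite skew_lift_gen mxE.
Qed.
End QuantumSkewDerivation.

(** * Column operations on quantum minors *)

Section AdjacentTransposition.
Variables (n : nat) (z zz : 'I_n).
Hypothesis zzE : zz = z.+1 :> nat.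
Local Notation sg := (tperm z zz).

Lemma neq_zzz : z != zz. Proof. by rewrite -val_eqE /= zzE; lia. Qed.

Lemma tperm_adj_val u :
  sg u = (if u == z then z.+1 else if u == zz then val z else val u) :> nat.
Proof.
have [->|uz] := eqVneq u z; first by rewrite tpermL zzE.
by have [->|uzz] := eqVneq u zz; rewrite ?tpermR // tpermD // eq_sym.
Qed.

Lemma tperm_adj_ltn u v :
  ~~ ((u == z) && (v == zz)) -> ~~ ((u == zz) && (v == z)) ->
  (sg u < sg v)%N = (u < v)%N.
Proof.
rewrite !tperm_adj_val -!val_eqE /=.
by do !case: eqP => //=; lia.
Qed.

Variables (p : nat) (f : 'I_p -> 'I_n).
Hypothesis injf : injective f.

Lemma inversions_tperm_off :
  (forall i, f i != z) \/ (forall i, f i != zz) ->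
  inversions (fun i => sg (f i)) = inversions (fun i => f i).
Proof.
move=> off; apply: eq_card => ij; rewrite !inE /=; congr (_ && _).
by apply: tperm_adj_ltn; case: off => h; rewrite !(negbTE (h _)) ?andbF.
Qed.

(** The adjacent transposition alters the comparison of the values [z] and [zz] only, so [(i0, j0)]
    is the one inversion created. *)
Lemma inversions_tperm_swap i0 j0 : f i0 = z -> f j0 = zz -> (i0 < j0)%N ->
  inversions (fun i => sg (f i)) = (inversions (fun i => f i)).+1.
Proof.
move=> fi fj ij0; rewrite /inversions.
set S := [set ij | _]; set S' := [set ij | _].
have -> : S = (i0, j0) |: S'.
  apply/setP=> -[i j]; rewrite !inE /=.
  have [[-> ->]|ne] := eqVneq (i, j) (i0, j0).
    by rewrite /= fi fj tpermL tpermR ij0 zzE ltnSn.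
  rewrite /=; have [ij|//] := ltnP i j; rewrite /=.
  apply: (tperm_adj_ltn).
    apply/negP=> /andP[/eqP fjz /eqP fizz].
    have ei : i = j0 by apply: injf; rewrite fizz fj.
    have ej : j = i0 by apply: injf; rewrite fjz fi.
    by move: ij; rewrite ei ej; lia.
  apply/negP=> /andP[/eqP fjz /eqP fiz]; move/eqP: ne; apply.
  by congr (_, _); apply: injf; rewrite ?fiz ?fjz ?fi ?fj.
by rewrite cardsU1 inE /= ij0 fi fj zzE ltnNge leqnSn.
Qed.

(** This turns an exchange of columns into a reindexing of the sum over permutations. *)
Lemma tperm_adj_swap i0 j0 i : f i0 = z -> f j0 = zz -> sg (f i) = f (tperm i0 j0 i).
Proof.
move=> fi fj; case: (tpermP i0 j0 i) => [->|->|/eqP ni /eqP nj].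
- by rewrite fi fj tpermL.
- by rewrite fi fj tpermR.
by rewrite tpermD // -?fi -?fj eq_sym (inj_eq injf).
Qed.
End AdjacentTransposition.

(** * Skew derivations of words in the generators *)

Section WordDerivation.
Variables (kq : comUnitRingType) (q : kq) (n : nat) (A : algType kq).
Variable x : 'I_n -> 'I_n -> A.
Hypothesis uq : q \is a GRing.unit.
Variables z zz : 'I_n.
Hypothesis zzE : zz = z.+1 :> nat.
Local Notation sg := (tperm z zz).

Definition mword (l : seq ('I_n * 'I_n)) : A := \prod_(u <- l) x u.1 u.2.
Definition mcols (l : seq ('I_n * 'I_n)) : seq 'I_n := map snd l.
Definition mswap (l : seq ('I_n * 'I_n)) := [seq (u.1, sg u.2) | u <- l].

Definition diag_morphism (K : A -> A) :=
  [/\ forall u v, K (u + v) = K u + K v, forall c u, K (c *: u) = c *: K u,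
      K 1 = 1, forall u v, K (u * v) = K u * K v &
      forall i j, K (x i j) = kappa q z zz j *: x i j].

Definition skew_derivation (K D : A -> A) (a b : 'I_n) :=
  [/\ forall u v, D (u + v) = D u + D v, forall c u, D (c *: u) = c *: D u,
      forall u v, D (u * v) = D u * K v + u * D v &
      forall i j, D (x i j) = if j == a then x i b else 0].

Lemma mword_cons u l : mword (u :: l) = x u.1 u.2 * mword l.
Proof. exact: big_cons. Qed.

Lemma mcols_mswap l : mcols (mswap l) = map sg (mcols l).
Proof. by rewrite /mcols /mswap -!map_comp. Qed.

Lemma mem_mswap_cols l j : (j \in mcols (mswap l)) = (sg j \in mcols l).
Proof.
by rewrite mcols_mswap -{1}(tpermK z zz j) mem_map //; exact: perm_inj.
Qed.

Section Derivation.
Variables (a b : 'I_n) (K D : A -> A).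
Hypothesis ab : (a, b) = (z, zz) \/ (a, b) = (zz, z).
Hypothesis Kdiag : diag_morphism K.
Hypothesis Dskew : skew_derivation K D a b.

Lemma sg_ab : sg a = b.
Proof. by case: ab => -[-> ->]; rewrite ?tpermL ?tpermR. Qed.

Lemma sg_off j : j != a -> j != b -> sg j = j.
Proof. by case: ab => -[-> ->] h1 h2; rewrite tpermD // eq_sym. Qed.

Lemma kappa_off j : j != a -> j != b -> kappa q z zz j = 1.
Proof.
by rewrite /kappa; case: ab => -[-> ->] /negbTE h1 /negbTE h2; rewrite h1 h2.
Qed.

Lemma skewD1 : D 1 = 0.
Proof.
case: Dskew Kdiag => _ _ DM _ [_ _ K1 _ _].
have := DM 1 1; rewrite K1 !mulr1 mul1r => h.
by apply: (addrI (D 1)); rewrite addr0 -h.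
Qed.

Lemma skewD_cons u l :
  D (mword (u :: l)) = D (x u.1 u.2) * K (mword l) + x u.1 u.2 * D (mword l).
Proof. by case: Dskew => _ _ DM _; rewrite /mword big_cons DM. Qed.

Lemma diagK_mword l : K (mword l) = (\prod_(j <- mcols l) kappa q z zz j) *: mword l.
Proof.
case: Kdiag => _ KZ K1 KM Kx; rewrite /mword.
elim: l => [|u l IHl]; first by rewrite !big_nil scale1r.
by rewrite !big_cons KM Kx IHl -scalerAl -scalerAr scalerA.
Qed.

Lemma diagK_one l :
  uniq (mcols l) -> z \in mcols l -> zz \notin mcols l ->
  K (mword l) = q *: mword l.
Proof.
move=> ul zl zzl; rewrite diagK_mword (bigD1_seq z) //= {1}/kappa eqxx.
rewrite big1_seq ?mulr1 // => j /andP[/negbTE jz jl]; rewrite /kappa jz ifN //.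
by apply: contraNneq zzl => <-.
Qed.

Lemma diagK_off l : a \notin mcols l -> b \notin mcols l -> K (mword l) = mword l.
Proof.
move=> al bl; rewrite diagK_mword big1_seq ?scale1r // => j /andP[_ jl].
by rewrite kappa_off //; [apply: contraNneq al|apply: contraNneq bl] => <-.
Qed.

Lemma skewD_off l : a \notin mcols l -> D (mword l) = 0.
Proof.
case: (Dskew) => _ _ _ Dx.
elim: l => [|u l IHl]; first by rewrite /mword big_nil skewD1.
rewrite inE negb_or => /andP[ua /IHl Dl].
by rewrite skewD_cons Dl Dx eq_sym (negbTE ua) mul0r mulr0 addr0.
Qed.

Lemma mswap_off l : a \notin mcols l -> b \notin mcols l -> mswap l = l.
Proof.
elim: l => //= u l IHl; rewrite !inE !negb_or => /andP[au /IHl al] /andP[bu /al ->].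
by rewrite sg_off 1?eq_sym //; case: u {au bu}.
Qed.

(** Only the letter in column [a] contributes. The letters to its right avoid [a] and [b], so K
    fixes them, and as [b] is absent, replacing [a] by [b] is the full exchange. *)
Lemma skewD_one l : uniq (mcols l) -> a \in mcols l -> b \notin mcols l ->
  D (mword l) = mword (mswap l).
Proof.
case: (Dskew) => _ _ _ Dx.
elim: l => //= u l IHl /andP[ul unil].
rewrite !inE negb_or => aul /andP[bu bl].
rewrite skewD_cons Dx mword_cons -/(mswap _) /=.
move: aul; rewrite [a == _]eq_sym; have [ua _|ua /= al] := eqVneq u.2 a.
  rewrite ua in ul *; rewrite sg_ab diagK_off // skewD_off // mulr0 addr0.
  by rewrite mswap_off.
by rewrite mul0r add0r IHl // sg_off // eq_sym.
Qed.
End Derivation.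

(* In a minor that contains both columns, the coefficients of these two words are
   (-q)^-(m+1) and (-q)^-m, so that their images under [D] cancel. *)
Lemma skewD_swap (K D : A -> A) l :
  diag_morphism K -> skew_derivation K D zz z ->
  uniq (mcols l) -> zz \in mcols l -> (index z (mcols l) < index zz (mcols l))%N ->
  D (mword (mswap l)) = q *: D (mword l).
Proof.
move=> Kdiag Dskew; have ab : (zz, z) = (z, zz) \/ (zz, z) = (zz, z) by right.
case: (Dskew) => _ _ _ Dx.
have zzz := neq_zzz zzE.
elim: l => //= u l IHl /andP[ul unil]; rewrite inE.
rewrite -/(mswap _) !(skewD_cons Dskew) !Dx /=.
have [uz|uz] := eqVneq u.2 z.
  rewrite uz in ul *; rewrite tpermL eqxx (negbTE zzz) mul0r add0r [zz == _]eq_sym.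
  rewrite (negbTE zzz) /= => zzl _.
  (* After the exchange the derivation acts on the head, and K acts on a tail that contains [z] but
     not [zz]: this is the factor q. *)
  have zs : z \in mcols (mswap l) by rewrite mem_mswap_cols tpermL.
  have zzs : zz \notin mcols (mswap l) by rewrite mem_mswap_cols tpermR.
  have us : uniq (mcols (mswap l)).
    by rewrite mcols_mswap map_inj_uniq //; exact: perm_inj.
  rewrite (diagK_one Kdiag) // (skewD_off Kdiag Dskew zzs) mulr0 addr0.
  by rewrite (skewD_one ab Kdiag Dskew) // scalerAr.
have [//|uzz /= zzl lt] := eqVneq u.2 zz.
have -> : sg u.2 = u.2 by rewrite tpermD // eq_sym.
rewrite (negbTE uzz) !mul0r !add0r IHl //.
by rewrite scalerAr.
Qed.
End WordDerivation.

(** * Minors with columns in arbitrary order *)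

Section ColumnMinors.
Variables (kq : comUnitRingType) (q : kq) (n : nat) (A : algType kq).
Variable x : 'I_n -> 'I_n -> A.
Hypothesis uq : q \is a GRing.unit.
Variables z zz : 'I_n.
Hypothesis zzE : zz = z.+1 :> nat.
Local Notation sg := (tperm z zz).

(** With the inversions of [B \o s] in place of those of [s], the sum does not depend on the order
    of the columns; for distinct columns it is the minor on the sorted ones, by [colminor_tord]. *)
Definition colminor p (R B : 'I_p -> 'I_n) : A :=
  \sum_(s : 'S_p) (- q) ^- inversions (fun i => B (s i)) *:
    \prod_(i < p) x (R i) (B (s i)).

Definition perm_word p (R B : 'I_p -> 'I_n) (s : 'S_p) :=
  [seq (R i, B (s i)) | i <- enum 'I_p].

Lemma mword_perm p (R B : 'I_p -> 'I_n) (s : 'S_p) :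
  \prod_(i < p) x (R i) (B (s i)) = mword x (perm_word R B s).
Proof. by rewrite /mword /perm_word big_map enumT unlock. Qed.

Lemma mcols_perm p (R B : 'I_p -> 'I_n) (s : 'S_p) :
  mcols (perm_word R B s) = [seq B (s i) | i <- enum 'I_p].
Proof. by rewrite /mcols -map_comp. Qed.

Lemma mswap_perm p (R B : 'I_p -> 'I_n) (s : 'S_p) :
  mswap z zz (perm_word R B s) = perm_word R (sg \o B) s.
Proof. by rewrite /mswap -map_comp. Qed.

Lemma mem_perm_word p (R B : 'I_p -> 'I_n) (s : 'S_p) i :
  B i \in mcols (perm_word R B s).
Proof.
by rewrite mcols_perm -(permKV s i); apply: map_f; rewrite mem_enum.
Qed.

Lemma mem_perm_wordN p (R B : 'I_p -> 'I_n) (s : 'S_p) j :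
  (forall i, B i != j) -> j \notin mcols (perm_word R B s).
Proof.
move=> Bj; rewrite mcols_perm; apply/negP=> /mapP[i _ jE].
by have := Bj (s i); rewrite jE eqxx.
Qed.

Lemma uniq_perm_word p (R B : 'I_p -> 'I_n) (s : 'S_p) :
  injective B -> uniq (mcols (perm_word R B s)).
Proof.
move=> injB; rewrite mcols_perm map_inj_uniq ?enum_uniq // => i j /injB.
exact: perm_inj.
Qed.

Lemma index_perm_word p (R B : 'I_p -> 'I_n) (s : 'S_p) i :
  injective B -> index (B i) (mcols (perm_word R B s)) = (s^-1)%g i.
Proof.
move=> injB; rewrite mcols_perm -{1}(permKV s i).
rewrite (index_map (f := fun i => B (s i))); last by move=> ? ? /injB/perm_inj.
exact: index_enum_ord.
Qed.

Section Diagonal.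
Variable K : A -> A.
Hypothesis Kdiag : diag_morphism q x z zz K.

Lemma diagK0 : K 0 = 0.
Proof. by case: Kdiag => _ KZ _ _ _; rewrite -(scale0r 0) KZ !scale0r. Qed.

Lemma diagK_colminor p (R B : 'I_p -> 'I_n) i0 :
  injective B -> B i0 = z -> (forall i, B i != zz) ->
  K (colminor R B) = q *: colminor R B.
Proof.
move=> injB Bz Bzz; case: (Kdiag) => KD KZ _ _ _.
rewrite /colminor (big_morph K KD diagK0) scaler_sumr; apply: eq_bigr => s _.
rewrite KZ mword_perm (diagK_one Kdiag) ?uniq_perm_word ?mem_perm_wordN //.
  by rewrite !scalerA mulrC.
by rewrite -Bz mem_perm_word.
Qed.

Section Derivation.
Variables (a b : 'I_n) (D : A -> A).
Hypothesis ab : (a, b) = (z, zz) \/ (a, b) = (zz, z).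
Hypothesis Dskew : skew_derivation x K D a b.

Lemma skewD0 : D 0 = 0.
Proof. by case: Dskew => _ DZ _ _; rewrite -(scale0r 0) DZ !scale0r. Qed.

Lemma skewD_colminor_off p (R B : 'I_p -> 'I_n) :
  (forall i, B i != a) -> D (colminor R B) = 0.
Proof.
move=> Ba; case: (Dskew) => DD DZ _ _.
rewrite /colminor (big_morph D DD skewD0) big1 // => s _.
by rewrite DZ mword_perm (skewD_off Kdiag Dskew) ?scaler0 ?mem_perm_wordN.
Qed.

Lemma skewD_colminor_one p (R B : 'I_p -> 'I_n) i0 :
  injective B -> B i0 = a -> (forall i, B i != b) ->
  D (colminor R B) = colminor R (sg \o B).
Proof.
move=> injB Ba Bb; case: (Dskew) => DD DZ _ _.
rewrite /colminor (big_morph D DD skewD0); apply: eq_bigr => s _.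
rewrite DZ !mword_perm (skewD_one ab Kdiag Dskew) ?uniq_perm_word ?mem_perm_wordN //;
  last by rewrite -Ba mem_perm_word.
rewrite mswap_perm (inversions_tperm_off zzE (f := fun i => B (s i))) //.
by case: ab => -[_ bE]; [right|left] => i; rewrite -bE Bb.
Qed.
End Derivation.

(** The terms of [s] and [s * tperm i0 j0] cancel: their words differ by the exchange of the columns
    [z] and [zz]. *)
Lemma skewD_colminor_both p (R B : 'I_p -> 'I_n) (D : A -> A) i0 j0 :
  skew_derivation x K D zz z ->
  injective B -> B i0 = z -> B j0 = zz -> D (colminor R B) = 0.
Proof.
move=> Dskew injB Bz Bzz; case: (Dskew) => DD DZ _ _.
have ij0 : i0 != j0.
  by apply/eqP=> E; have := neq_zzz zzE; rewrite -Bz -Bzz E eqxx.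
(* [P s] says that column [z] stands left of column [zz] in the word of [s]; the transposition
   exchanges [P] with its complement. *)
pose P (s : 'S_p) := ((s^-1)%g i0 < (s^-1)%g j0)%N.
rewrite /colminor (big_morph D DD (skewD0 Dskew)) (bigID P) /=.
rewrite [X in _ + X](reindex_inj (mulIg (tperm i0 j0))) /=.
have PE s : ~~ P (s * tperm i0 j0)%g = P s.
  rewrite /P invMg !permM tpermV tpermL tpermR -leqNgt leq_eqVlt.
  by rewrite val_eqE (inj_eq perm_inj) (negbTE ij0).
rewrite (eq_bigl _ _ PE) -big_split big1 //= => s Ps.
have Es i : B ((s * tperm i0 j0)%g i) = sg (B (s i)).
  by rewrite permM (tperm_adj_swap injB _ Bz Bzz).
rewrite !DZ !mword_perm.
have -> : perm_word R B (s * tperm i0 j0)%g = mswap z zz (perm_word R B s).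
  by rewrite mswap_perm; apply: eq_map => i; rewrite Es.
rewrite (skewD_swap zzE Kdiag Dskew) ?uniq_perm_word //; first last.
- by rewrite -Bz -Bzz !index_perm_word.
- by rewrite -Bzz mem_perm_word.
have -> : inversions (fun i => B ((s * tperm i0 j0)%g i)) =
          (inversions (fun i => B (s i))).+1.
  rewrite -(inversions_tperm_swap zzE (f := fun i => B (s i)) _ _ _ Ps) ?permKV //.
    by apply: eq_card => ij; rewrite !inE !Es.
  by move=> ? ? /injB/perm_inj.
rewrite exprS invrM ?unitrX ?unitrN // scalerA -mulrA invrN mulNr mulVr //.
by rewrite mulrN mulr1 scaleNr addrN.
Qed.
End Diagonal.

(** The sum runs over all arrangements of the columns, which the exchange merely permutes. *)
Lemma colminor_tperm_both p (R B : 'I_p -> 'I_n) i0 j0 :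
  injective B -> B i0 = z -> B j0 = zz ->
  colminor R (sg \o B) = colminor R B.
Proof.
move=> injB Bz Bzz; rewrite [RHS](reindex_inj (mulIg (tperm i0 j0))) /=.
apply: eq_bigr => s _.
have Es i : B ((s * tperm i0 j0)%g i) = sg (B (s i)).
  by rewrite permM (tperm_adj_swap injB _ Bz Bzz).
congr (_ ^- _ *: _); first by apply: eq_card => ij; rewrite !inE !Es.
by apply: eq_bigr => i _; rewrite Es.
Qed.

(** The added power of -q is the column part of the normalization of extended minors; the rows are
    used as given. *)
Definition nminor p (R B : 'I_p -> 'I_n) : A :=
  (- q) ^- inversions (fun i => B i) *: colminor R B.

(** Only the normalizing power changes, by the inversion that the exchange creates or removes. *)
Lemma nminor_tperm_both p (R B : 'I_p -> 'I_n) i0 j0 :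
  injective B -> B i0 = z -> B j0 = zz ->
  nminor R (sg \o B) = (if (i0 < j0)%N then - q^-1 else - q) *: nminor R B.
Proof.
move=> injB Bz Bzz; rewrite /nminor (colminor_tperm_both _ injB Bz Bzz) scalerA.
congr (_ *: _); case: ltnP => [ij|].
  rewrite (inversions_tperm_swap zzE injB Bz Bzz ij) exprS.
  by rewrite invrM ?unitrX ?unitrN // invrN mulrC.
rewrite leq_eqVlt => /predU1P[/val_inj E|ji].
  by have := neq_zzz zzE; rewrite -Bz -Bzz E eqxx.
(* The previous count is applied to [sg \o B], where [z] does come first. *)
have sBz : (sg \o B) j0 = z by rewrite /= Bzz tpermR.
have sBzz : (sg \o B) i0 = zz by rewrite /= Bz tpermL.
have := inversions_tperm_swap zzE (inj_comp (@perm_inj _ sg) injB) sBz sBzz ji.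
have -> : inversions (fun i => sg ((sg \o B) i)) = inversions (fun i => B i).
  by apply: eq_card => ij; rewrite !inE /= !tpermK.
move=> ->; rewrite exprS invrM ?unitrX ?unitrN // mulrCA.
by rewrite mulrV ?unitrN // mulr1.
Qed.

Lemma nminor_ext p (R B B' : 'I_p -> 'I_n) : B =1 B' -> nminor R B = nminor R B'.
Proof.
move=> BB'; rewrite /nminor; congr (_ ^- _ *: _).
  by apply: eq_card => ij; rewrite !inE !BB'.
apply: eq_bigr => s _; congr (_ ^- _ *: _).
  by apply: eq_card => ij; rewrite !inE !BB'.
by apply: eq_bigr => i _; rewrite BB'.
Qed.

Lemma nminor_tperm_off p (R B : 'I_p -> 'I_n) :
  (forall i, B i != z) -> (forall i, B i != zz) ->
  nminor R (sg \o B) = nminor R B.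
Proof.
by move=> Bz Bzz; apply: nminor_ext => i /=; rewrite tpermD // eq_sym.
Qed.

Section Hecke.
Variables (K K' E F : A -> A).
Hypothesis Kdiag : diag_morphism q x z zz K.
Hypothesis K'diag : diag_morphism q x z zz K'.
Hypothesis Eskew : skew_derivation x K E zz z.
Hypothesis Fskew : skew_derivation x K' F z zz.

(* On the weight space of E and F in which the columns z and z + 1 occur once
   each, FE has the eigenvalues 0 and 1 + q^2, so this operator satisfies
   (T - q)(T + q^-1) = 0: it is the Hecke generator of the recursion for C_i^I. *)
Definition hecke (u : A) : A := q^-1 *: (F (E u) - u).

Lemma heckeD u v : hecke (u + v) = hecke u + hecke v.
Proof.
case: Eskew Fskew => ED _ _ _ [FD _ _ _].
by rewrite /hecke ED FD opprD addrACA scalerDr.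
Qed.

Lemma heckeZ c u : hecke (c *: u) = c *: hecke u.
Proof.
case: Eskew Fskew => _ EZ _ _ [_ FZ _ _].
by rewrite /hecke EZ FZ -scalerBr !scalerA mulrC.
Qed.

Let Eab : (zz, z) = (z, zz) \/ (zz, z) = (zz, z). Proof. by right. Qed.
Let Fab : (z, zz) = (z, zz) \/ (z, zz) = (zz, z). Proof. by left. Qed.

Lemma skewD_nminor_off (K0 D : A -> A) a b p (R B : 'I_p -> 'I_n) :
  diag_morphism q x z zz K0 -> skew_derivation x K0 D a b ->
  (forall i, B i != a) -> D (nminor R B) = 0.
Proof.
move=> Kd Dd Ba; case: (Dd) => _ DZ _ _.
by rewrite DZ (skewD_colminor_off Kd Dd) ?scaler0.
Qed.

Lemma skewD_nminor_one (K0 D : A -> A) a b p (R B : 'I_p -> 'I_n) i0 :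
  (a, b) = (z, zz) \/ (a, b) = (zz, z) ->
  diag_morphism q x z zz K0 -> skew_derivation x K0 D a b ->
  injective B -> B i0 = a -> (forall i, B i != b) ->
  D (nminor R B) = nminor R (sg \o B).
Proof.
move=> ab Kd Dd injB Ba Bb; case: (Dd) => _ DZ _ _.
rewrite DZ (skewD_colminor_one Kd ab Dd _ injB Ba) // /nminor.
rewrite (inversions_tperm_off zzE (f := B)) //.
by case: ab => -[_ bE]; [right|left] => i; rewrite -bE Bb.
Qed.

Lemma diagK_nminor (K0 : A -> A) p (R B : 'I_p -> 'I_n) i0 :
  diag_morphism q x z zz K0 ->
  injective B -> B i0 = z -> (forall i, B i != zz) ->
  K0 (nminor R B) = q *: nminor R B.
Proof.
move=> Kd injB Bz Bzz; case: (Kd) => _ KZ _ _ _.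
by rewrite KZ (diagK_colminor Kd _ injB Bz) // !scalerA mulrC.
Qed.

Variables (p1 p2 : nat) (R1 B1 : 'I_p1 -> 'I_n) (R2 B2 : 'I_p2 -> 'I_n).
Hypotheses (inj1 : injective B1) (inj2 : injective B2).

Let EM u v : E (u * v) = E u * K v + u * E v. Proof. by case: Eskew. Qed.
Let FM u v : F (u * v) = F u * K' v + u * F v. Proof. by case: Fskew. Qed.
Let FZ c u : F (c *: u) = c *: F u. Proof. by case: Fskew. Qed.
Let sgK p (B : 'I_p -> 'I_n) : sg \o (sg \o B) =1 B.
Proof. by move=> i; rewrite /= tpermK. Qed.

Let u := nminor R1 B1 * nminor R2 B2.
Let su := nminor R1 (sg \o B1) * nminor R2 (sg \o B2).

(** Since E kills [u], the operator multiplies it by -q^-1, which is also -q - (q^-1 - q). *)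
Let hecke_both (b : bool) : E u = 0 ->
  su = (if b then - q^-1 else - q) *: u ->
  hecke u = su - (if b then 0 else q^-1 - q) *: u.
Proof.
move=> Eu ->; rewrite /hecke Eu -(scale0r 0) FZ scale0r sub0r scalerN.
rewrite -scaleNr -scalerBl; congr (_ *: _); case: b => //; first by rewrite subr0.
by rewrite opprB addKr.
Qed.

Lemma hecke_left i j : B1 i = z -> B1 j = zz ->
  (forall m, B2 m != z) -> (forall m, B2 m != zz) ->
  hecke u = su - (if (i < j)%N then 0 else q^-1 - q) *: u.
Proof.
move=> B1z B1zz B2z B2zz; apply: hecke_both.
  case: (Eskew) => _ EZ _ _.
  rewrite EM (skewD_nminor_off _ Kdiag Eskew B2zz) mulr0 addr0.
  rewrite [E (nminor R1 B1)]EZ.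
  by rewrite (skewD_colminor_both Kdiag _ Eskew inj1 B1z B1zz) scaler0 mul0r.
rewrite /su (nminor_tperm_off R2 B2z B2zz).
by rewrite (nminor_tperm_both _ inj1 B1z B1zz) scalerAl.
Qed.

Lemma hecke_right i j : B2 i = z -> B2 j = zz ->
  (forall m, B1 m != z) -> (forall m, B1 m != zz) ->
  hecke u = su - (if (i < j)%N then 0 else q^-1 - q) *: u.
Proof.
move=> B2z B2zz B1z B1zz; apply: hecke_both.
  case: (Eskew) => _ EZ _ _.
  rewrite EM (skewD_nminor_off _ Kdiag Eskew B1zz) mul0r add0r.
  rewrite [E (nminor R2 B2)]EZ.
  by rewrite (skewD_colminor_both Kdiag _ Eskew inj2 B2z B2zz) scaler0 mulr0.
rewrite /su (nminor_tperm_off R1 B1z B1zz).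
by rewrite (nminor_tperm_both _ inj2 B2z B2zz) scalerAr.
Qed.

Let sg_injl p (B : 'I_p -> 'I_n) : injective B -> injective (sg \o B).
Proof. by move=> iB; apply: inj_comp => //; exact: perm_inj. Qed.

Let sg_avoid p (B : 'I_p -> 'I_n) a b : sg a = b ->
  (forall m, B m != a) -> forall m, (sg \o B) m != b.
Proof. by move=> <- Ba m /=; rewrite (inj_eq (@perm_inj _ sg)). Qed.

(** E exchanges the columns in the second factor only. Then F gives back [u] and, since K' scales
    the second factor by q, also q times [su]. *)
Lemma hecke_split_lt i j : B1 i = z -> B2 j = zz ->
  (forall m, B1 m != zz) -> (forall m, B2 m != z) ->
  hecke u = su.
Proof.
move=> B1z B2zz B1N B2N; have s2N := sg_avoid (tpermL z zz) B2N.
have s2z : (sg \o B2) j = z by rewrite /= B2zz tpermR.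
rewrite /hecke EM (skewD_nminor_off _ Kdiag Eskew B1N) mul0r add0r.
rewrite (skewD_nminor_one _ Eab Kdiag Eskew inj2 B2zz B2N) FM.
rewrite (skewD_nminor_one _ Fab K'diag Fskew inj1 B1z B1N).
rewrite (skewD_nminor_one _ Fab K'diag Fskew (sg_injl inj2) s2z s2N).
rewrite (diagK_nminor _ K'diag (sg_injl inj2) s2z s2N).
rewrite (nminor_ext _ (sgK B2)) addrK -scalerAr scalerA mulVr //.
exact: scale1r.
Qed.

(** Here E acts on the first factor and K scales the second by q, so F E [u] is q^2 [u] plus q
    [su]. *)
Lemma hecke_split_gt i j : B1 i = zz -> B2 j = z ->
  (forall m, B1 m != z) -> (forall m, B2 m != zz) ->
  hecke u = su - (q^-1 - q) *: u.
Proof.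
move=> B1zz B2z B1N B2N; have s1N := sg_avoid (tpermL z zz) B1N.
have s1z : (sg \o B1) i = z by rewrite /= B1zz tpermR.
rewrite /hecke EM (skewD_nminor_off _ Kdiag Eskew B2N) mulr0 addr0.
rewrite (skewD_nminor_one _ Eab Kdiag Eskew inj1 B1zz B1N).
rewrite (diagK_nminor _ Kdiag inj2 B2z B2N) -scalerAr FZ FM.
rewrite (skewD_nminor_one _ Fab K'diag Fskew inj2 B2z B2N).
rewrite (skewD_nminor_one _ Fab K'diag Fskew (sg_injl inj1) s1z s1N).
rewrite (diagK_nminor _ K'diag inj2 B2z B2N).
rewrite (nminor_ext _ (sgK B1)) -scalerAr scalerBr scalerA mulVr // scale1r.
by rewrite scalerBl opprB addrA [su + _]addrC.
Qed.
End Hecke.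

End ColumnMinors.

(** * Minors indexed by tuples *)

Section TupleMinors.
Variables (kq : comUnitRingType) (q : kq) (n : nat) (A : algType kq).
Variable x : 'I_n -> 'I_n -> A.
Hypothesis uq : q \is a GRing.unit.

Lemma commr_nminor p1 p2 (R1 B1 : 'I_p1 -> 'I_n) (R2 B2 : 'I_p2 -> 'I_n) :
  (forall i j i' j', GRing.comm (x (R1 i) (B1 j)) (x (R2 i') (B2 j'))) ->
  GRing.comm (nminor q x R1 B1) (nminor q x R2 B2).
Proof.
move=> cx.
have cZ c (v w : A) : GRing.comm v w -> GRing.comm v (c *: w).
  by rewrite /GRing.comm -scalerAr -scalerAl => ->.
apply/cZ/commr_sum => s _; apply/cZ/commr_prod => i _; apply: commr_sym.
apply/cZ/commr_sum => t _; apply/cZ/commr_prod => j _; apply: commr_sym.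
exact: cx.
Qed.

Lemma commr_scale (c d : kq) (u v : A) :
  GRing.comm u v -> GRing.comm (c *: u) (d *: v).
Proof.
by rewrite /GRing.comm -!scalerAl -!scalerAr !scalerA mulrC => ->.
Qed.

Lemma sorted_ltn_tord p (B : p.-tuple 'I_n) : uniq B ->
  sorted ltn (map val (tord B)).
Proof.
move=> uB; rewrite ltn_sorted_uniq_leq map_inj_uniq; last exact: val_inj.
rewrite sort_uniq uB sorted_map; apply: sort_sorted => i j.
exact: leq_total.
Qed.

Lemma tnth_tord_ltn p (B : p.-tuple 'I_n) (i j : 'I_p) : uniq B ->
  (tnth (tord B) i < tnth (tord B) j)%N = (i < j)%N.
Proof.
move=> uB.
have mono (k l : 'I_p) : (k < l)%N -> (tnth (tord B) k < tnth (tord B) l)%N.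
  move=> kl; have := sorted_ltn_nth ltn_trans 0%N (sorted_ltn_tord uB).
  move=> /(_ k l); rewrite !inE size_map size_tuple !ltn_ord => /(_ isT isT kl).
  by rewrite !(nth_map (tnth B k)) ?size_tuple // -!tnth_nth.
case: (ltngtP i j) => [|ji|/val_inj ->]; [exact: mono| |exact: ltnn].
by apply/negbTE; rewrite -leqNgt ltnW // mono.
Qed.

(** Reindex by the permutation that sorts [B]: as the sorted tuple increases, inversions of
    permutations become inversions of columns. *)
Lemma colminor_tord p (R : 'I_p -> 'I_n) (B : p.-tuple 'I_n) : uniq B ->
  \sum_(s : 'S_p) (- q) ^- inversions (fun i => s i) *:
    \prod_(i < p) x (R i) (tnth (tord B) (s i)) = colminor q x R (tnth B).
Proof.
move=> uB; have /tuple_permP[t tE] : perm_eq (tord B) B by apply/permPl/perm_sort.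
have tordE i : tnth (tord B) i = tnth B (t i).
  have d := tnth B i; rewrite (tnth_nth d) tE.
  rewrite (nth_map i) ?size_tuple -?enumT ?size_enum_ord //.
  by rewrite nth_ord_enum.
rewrite /colminor [RHS](reindex_inj (mulIg t)) /=; apply: eq_bigr => s _.
congr (_ ^- _ *: _); last by apply: eq_bigr => i _; rewrite permM tordE.
by apply: eq_card => ij; rewrite !inE !permM -!tordE tnth_tord_ltn.
Qed.

Lemma nminor_tord p (R B : p.-tuple 'I_n) : uniq B ->
  (- q) ^- (tinv R + tinv B) *:
    \sum_(s : 'S_p) (- q) ^- inversions (fun i => s i) *:
      \prod_(i < p) x (tnth (tord R) i) (tnth (tord B) (s i))
  = (- q) ^- tinv R *: nminor q x (tnth (tord R)) (tnth B).
Proof.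
move=> uB; rewrite colminor_tord // /nminor scalerA.
by rewrite -invrM ?unitrX ?unitrN // mulrC -exprD.
Qed.

Variables z zz : 'I_n.
Hypothesis zzE : zz = z.+1 :> nat.
Local Notation sg := (tperm z zz).
Variables (K K' E F : A -> A).
Hypothesis Kdiag : diag_morphism q x z zz K.
Hypothesis K'diag : diag_morphism q x z zz K'.
Hypothesis Eskew : skew_derivation x K E zz z.
Hypothesis Fskew : skew_derivation x K' F z zz.

(** The four positions of [z] and [zz] share one formula: the order in the concatenated tuple is the
    order within a factor that holds both, and is decided by the factors otherwise. *)
Lemma hecke_tuple p1 p2 (R1 : 'I_p1 -> 'I_n) (R2 : 'I_p2 -> 'I_n)
    (S1 : p1.-tuple 'I_n) (S2 : p2.-tuple 'I_n) :
  uniq (S1 ++ S2) -> z \in S1 ++ S2 -> zz \in S1 ++ S2 ->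
  hecke q E F (nminor q x R1 (tnth S1) * nminor q x R2 (tnth S2)) =
  nminor q x R1 (tnth (map_tuple sg S1)) * nminor q x R2 (tnth (map_tuple sg S2))
  - (if (index z (S1 ++ S2) < index zz (S1 ++ S2))%N then 0 else q^-1 - q)
    *: (nminor q x R1 (tnth S1) * nminor q x R2 (tnth S2)).
Proof.
rewrite cat_uniq => /and3P[u1 /hasPn disj u2].
have inj1 : injective (tnth S1) by apply/tuple_uniqP.
have inj2 : injective (tnth S2) by apply/tuple_uniqP.
have mapE p (R : 'I_p -> 'I_n) (S : p.-tuple 'I_n) :
    nminor q x R (tnth (map_tuple sg S)) = nminor q x R (sg \o tnth S).
  by apply: nminor_ext => i; rewrite tnth_map.
have out1 j : j \in S2 -> forall m, tnth S1 m != j.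
  by move=> /disj /= j1 m; apply: contraNneq j1 => <-; exact: mem_tnth.
have out2 j : j \in S1 -> forall m, tnth S2 m != j.
  move=> j1 m; apply/eqP => mj; have := disj _ (mem_tnth m S2).
  by rewrite /= mj j1.
have idx p (S : p.-tuple 'I_n) i : injective (tnth S) -> index (tnth S i) S = i.
  move=> /tuple_uniqP uS.
  by rewrite {1}(tnth_nth (tnth S i)) index_uniq ?size_tuple.
rewrite !mapE !mem_cat !index_cat size_tuple.
case: (boolP (z \in S1)) => z1; case: (boolP (zz \in S1)) => zz1 /=.
- move=> _ _; case/tnthP: (z1) (zz1) => i Ei /tnthP[j Ej].
  have -> : index z S1 = i by rewrite Ei idx.
  have -> : index zz S1 = j by rewrite Ej idx.
  apply: (hecke_left uq zzE Kdiag Eskew Fskew); rewrite -?Ei -?Ej //; exact: out2.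
- move=> _ zz2; case/tnthP: (z1) (zz2) => i Ei /tnthP[j Ej].
  rewrite ltn_addr; last by rewrite -[X in (_ < X)%N](size_tuple S1) index_mem.
  rewrite scale0r subr0.
  apply: (hecke_split_lt uq zzE Kdiag K'diag Eskew Fskew R1 R2 inj1 inj2
            (esym Ei) (esym Ej)).
    exact: out1.
  exact: out2.
- move=> z2 _; case/tnthP: (zz1) (z2) => i Ei /tnthP[j Ej].
  rewrite ltnNge ltnW /=; last first.
    by apply: ltn_addr; rewrite -[X in (_ < X)%N](size_tuple S1) index_mem.
  apply: (hecke_split_gt uq zzE Kdiag K'diag Eskew Fskew R1 R2 inj1 inj2
            (esym Ei) (esym Ej)).
    exact: out1.
  exact: out2.
- move=> z2 zz2; case/tnthP: (z2) (zz2) => i Ei /tnthP[j Ej].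
  have -> : index z S2 = i by rewrite Ei idx.
  have -> : index zz S2 = j by rewrite Ej idx.
  rewrite ltn_add2l.
  apply: (hecke_right uq zzE Kdiag Eskew Fskew); rewrite -?Ei -?Ej //; exact: out1.
Qed.

(** The scalars [c] and [d] make room for the row normalization of [qminor]. *)
Lemma hecke_tuple_scale p1 p2 (R1 : 'I_p1 -> 'I_n) (R2 : 'I_p2 -> 'I_n)
    (S1 : p1.-tuple 'I_n) (S2 : p2.-tuple 'I_n) (c d : kq) :
  uniq (S1 ++ S2) -> z \in S1 ++ S2 -> zz \in S1 ++ S2 ->
  hecke q E F ((c *: nminor q x R1 (tnth S1)) * (d *: nminor q x R2 (tnth S2))) =
  (c *: nminor q x R1 (tnth (map_tuple sg S1))) *
  (d *: nminor q x R2 (tnth (map_tuple sg S2)))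
  - (if (index z (S1 ++ S2) < index zz (S1 ++ S2))%N then 0 else q^-1 - q)
    *: ((c *: nminor q x R1 (tnth S1)) * (d *: nminor q x R2 (tnth S2))).
Proof.
move=> uS zS zzS; 
have ZM (u v : A) : (c *: u) * (d *: v) = (c * d) *: (u * v).
  by rewrite -scalerAl -scalerAr scalerA.
rewrite !ZM (heckeZ q Eskew Fskew) hecke_tuple // scalerBr !scalerA.
by congr (_ - _ *: _); rewrite mulrC.
Qed.
End TupleMinors.

(** * The Hecke operator on products of quantum minors *)

Section QuantumMinorHecke.
Variables (kq : comUnitRingType) (q : kq) (n : nat).
Hypothesis uq : q \is a GRing.unit.
Let A : algType kq := qmx q n.
Let x : 'I_n -> 'I_n -> A := @qgen kq q n.

Lemma qminorE p (R B : p.-tuple 'I_n) : uniq B ->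
  qminor q R B = (- q) ^- tinv R *: nminor q x (tnth (tord R)) (tnth B) :> A.
Proof.
exact: (nminor_tord x uq).
Qed.

(** A single operator must serve all row tuples and both orders of the factors, since it is applied
    to each side of the theorem. *)
Lemma hecke_qmx (z zz : 'I_n) : zz = z.+1 :> nat ->
  exists T : A -> A,
  [/\ forall u v, T (u + v) = T u + T v, forall c u, T (c *: u) = c *: T u &
   forall p1 p2 (R1 S1 : p1.-tuple 'I_n) (R2 S2 : p2.-tuple 'I_n),
   uniq (S1 ++ S2) -> z \in S1 ++ S2 -> zz \in S1 ++ S2 ->
   T (qminor q R1 S1 * qminor q R2 S2) =
     qminor q R1 (map_tuple (tperm z zz) S1) *
     qminor q R2 (map_tuple (tperm z zz) S2)
     - (if (index z (S1 ++ S2) < index zz (S1 ++ S2))%N then 0 else q^-1 - q)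
       *: (qminor q R1 S1 * qminor q R2 S2)].
Proof.
move=> zzE.
have [K [E [Kdiag Eskew]]] :=
  qmx_skew_derivation uq zzE (or_intror (erefl (zz, z))).
have [K' [F [K'diag Fskew]]] :=
  qmx_skew_derivation uq zzE (or_introl (erefl (z, zz))).
have {}Kdiag : diag_morphism q x z zz K := Kdiag.
have {}K'diag : diag_morphism q x z zz K' := K'diag.
have {}Eskew : skew_derivation x K E zz z := Eskew.
have {}Fskew : skew_derivation x K' F z zz := Fskew.
exists (hecke q E F); split.
- exact: (heckeD q Eskew Fskew).
- exact: (heckeZ q Eskew Fskew).
move=> p1 p2 R1 S1 R2 S2 uS zS zzS.
have := uS; rewrite cat_uniq => /and3P[u1 _ u2].
have um p (S : p.-tuple 'I_n) : uniq S -> uniq (map_tuple (tperm z zz) S).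
  by rewrite map_inj_uniq //; exact: perm_inj.
rewrite !qminorE ?um //.
exact: (hecke_tuple_scale uq zzE Kdiag K'diag Eskew Fskew).
Qed.

(** Each generator of one minor lies above and to the right of each generator of the other, so they
    commute. *)
Lemma commr_qminor p1 p2 (R1 B1 : p1.-tuple 'I_n) (R2 B2 : p2.-tuple 'I_n) :
  uniq B1 -> uniq B2 ->
  (forall i j, i \in R1 -> j \in R2 -> (i < j)%N) ->
  (forall i j, i \in B1 -> j \in B2 -> (j < i)%N) ->
  qminor q R2 B2 * qminor q R1 B1 = qminor q R1 B1 * qminor q R2 B2 :> A.
Proof.
move=> u1 u2 lR lB; have E1 := qminorE R1 u1; have E2 := qminorE R2 u2.
apply: (etrans (congr2 *%R E2 E1)); apply: (etrans _ (esym (congr2 *%R E1 E2))).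
have cx i j i' j' : GRing.comm (x (tnth (tord R1) i) (tnth B1 j))
                               (x (tnth (tord R2) i') (tnth B2 j')).
  have mR p (R : p.-tuple 'I_n) m : tnth (tord R) m \in R.
    by rewrite -(mem_sort (fun i j : 'I_n => (i <= j)%N)) mem_tnth.
  exact: (qgen_anti q (lR _ _ (mR _ _ _) (mR _ _ _))
                      (lB _ _ (mem_tnth _ _) (mem_tnth _ _))).
exact: (esym (commr_scale _ _ (commr_nminor q cx))).
Qed.
End QuantumMinorHecke.

(** * The standard tower *)

Section TowerFacts.
Variables r s : nat.
Local Notation n := (r + s)%N.
Local Notation word RR := (tval RR.1 ++ tval RR.2).
Implicit Types (I J : r.-tuple 'I_n).
Implicit Types RR : r.-tuple 'I_n * s.-tuple 'I_n.

Lemma increasing_uniq p (S : p.-tuple 'I_n) : increasing S -> uniq S.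
Proof.
move=> iS; apply: (sorted_uniq _ _ iS); last by move=> i; exact: ltnn.
by move=> ? ? ?; exact: ltn_trans.
Qed.

Lemma increasing_eq p (S S' : p.-tuple 'I_n) :
  increasing S -> increasing S' -> S =i S' -> S = S'.
Proof.
move=> iS iS' SS'; apply: val_inj; apply: (irr_sorted_eq _ _ iS iS' SS').
  by move=> ? ? ?; exact: ltn_trans.
by move=> i; exact: ltnn.
Qed.

Lemma mem_top_cols (j : 'I_n) : (j \in top_cols r s) = (s <= j)%N.
Proof.
apply/tnthP/idP => [[i ->]|sj]; first by rewrite tnth_mktuple /= leq_addr.
have lt : (j - s < r)%N by have := ltn_ord j; lia.
by exists (Ordinal lt); apply: val_inj; rewrite tnth_mktuple /= subnKC.
Qed.

Lemma mem_top_compl (j : 'I_n) : (j \in top_compl r s) = (j < s)%N.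
Proof.
apply/tnthP/idP => [[i ->]|lt]; first by rewrite tnth_mktuple /=.
by exists (Ordinal lt); apply: val_inj; rewrite tnth_mktuple.
Qed.

Lemma uniq_top_cols : uniq (top_cols r s).
Proof.
rewrite map_inj_uniq ?enum_uniq // => i j /(congr1 val) /= /addnI.
exact: val_inj.
Qed.

Lemma increasing_top_compl : increasing (top_compl r s).
Proof.
rewrite /increasing /= sorted_map; have := iota_ltn_sorted 0 s.
by rewrite -val_enum_ord sorted_map.
Qed.

Lemma top_word : uniq (top_cols r s ++ top_compl r s) /\
  forall j, j \in top_cols r s ++ top_compl r s.
Proof.
split; last by move=> j; rewrite mem_cat mem_top_cols mem_top_compl leqNgt orNb.
rewrite cat_uniq uniq_top_cols increasing_uniq ?increasing_top_compl // andbT.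
by apply/hasPn => j /=; rewrite mem_top_cols mem_top_compl ltnNge.
Qed.

(** Every step of the recursion keeps a pair or permutes its values, so the pairs stay arrangements
    of all the indices, as the Hecke formula requires. *)
Lemma Clist_rec_word I t i RR : RR \in Clist_rec I t i ->
  uniq (word RR) /\ forall j, j \in word RR.
Proof.
have perm_word (g : {perm 'I_n}) (w : seq 'I_n) :
    uniq w /\ (forall j, j \in w) -> uniq (map g w) /\ forall j, j \in map g w.
  case=> uw mw; rewrite map_inj_uniq; last exact: perm_inj.
  by split=> // j; rewrite -(permKV g j) mem_map //; exact: perm_inj.
elim: t i RR => [|t IHt] i RR /=.
  by case: i => // ; rewrite inE => /eqP ->; exact: top_word.
rewrite mem_cat => /orP[|/mapP[RR' /IHt wR ->]]; last first.
  by rewrite /= -map_cat; exact: perm_word.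
by case: i => // i; rewrite mem_filter => /andP[_ /IHt].
Qed.

(** [intc] is the first time at which the top tuple is reached. *)
Lemma iter_std_step_neq_top I m : increasing I -> (m < intc I)%N ->
  iter m (@std_step r s) I != top_cols r s.
Proof.
move=> incI mN; apply/eqP => E.
have conn : fconnect (@std_step r s) I (top_cols r s).
  by rewrite -(iter_intc incI); exact: fconnect_iter.
have := findex_iter (ltn_trans mN (findex_max conn)).
by rewrite E -/(intc I) => e; rewrite e ltnn in mN.
Qed.

Lemma iter_std_step_increasing I m : increasing I -> (m <= intc I)%N ->
  increasing (iter m (@std_step r s) I).
Proof.
move=> incI; elim: m => //= m IHm mN; apply: std_step_increasing.
  exact/IHm/ltnW.
exact: iter_std_step_neq_top.
Qed.

Lemma std_step_tower I t : (t < intc I)%N -> std_step (tower I t.+1) = tower I t.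
Proof. by move=> tN; rewrite /tower -iterS subnSK. Qed.

(** The gap above the moved entry leaves its successor free and below [n], so that [ordS] does not
    wrap around. *)
Lemma std_entry_adj J : increasing J -> J != top_cols r s ->
  exists2 z, std_entry J = Some z &
    [/\ z \in J, ordS z \notin J & ordS z = z.+1 :> nat].
Proof.
move=> incJ Jtop; have [p Ep] := std_entryP incJ Jtop.
rewrite /gap_at nth_val ltn_subRL addn1 => gp; exists (tnth J p) => //.
have ltz : ((tnth J p).+1 < n)%N by exact: leq_trans gp (nth_val_max _ _).
have oE : ordS (tnth J p) = (tnth J p).+1 :> nat by rewrite /= modn_small.
split=> //; first exact: mem_tnth.
apply/negP => /tnthP[i iE]; move: (oE); rewrite iE => vE.
case: (leqP i p) => [ip|pi].
  by have := nth_val_leq incJ ip; rewrite !nth_val vE ltnn.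
by have := leq_trans gp (nth_val_leq incJ pi); rewrite nth_val vE ltnn.
Qed.

(** * The recursion for the lists as an operator identity *)

Section Recursion.
Variables (kq : comUnitRingType) (A : lmodType kq) (h : kq).
Variables (W : r.-tuple 'I_n * s.-tuple 'I_n -> A) (T : A -> A).
Hypothesis TD : forall u v, T (u + v) = T u + T v.
Hypothesis TZ : forall c u, T (c *: u) = c *: T u.

(** The right-hand side at level [t] of the tower, with an abstract weight [W] and the signs
    absorbed in the powers of [- h]. *)
Definition Csum I t :=
  \sum_(i < t.+1) (- h) ^+ i *: \sum_(RR <- Clist_rec I t i) W RR.

Lemma Csum_intc I : Csum I (intc I) =
  \sum_(i < (intc I).+1) ((-1) ^+ i * h ^+ i) *: \sum_(RR <- Clist I i) W RR.
Proof. by apply: eq_bigr => i _; rewrite -exprMn mulN1r. Qed.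

(** The operator sends a pair to its image under the transposition, in the same degree, and, if the
    pair is not in phi, to itself times [- h], one degree up: these are the two parts of the
    concatenation. *)
Lemma Csum_rec I t :
  (forall i RR, RR \in Clist_rec I t i -> T (W RR) =
     W (permt (std_perm (tower I t.+1)) RR.1, permt (std_perm (tower I t.+1)) RR.2)
     - (if in_phi (tower I t.+1) RR then 0 else h) *: W RR) ->
  T (Csum I t) = Csum I t.+1.
Proof.
move=> TW; have T0 : T 0 = 0 by have := TZ 0 0; rewrite !scale0r.
set sg := std_perm _ in TW.
pose Bs i := \sum_(RR <- Clist_rec I t i) W (permt sg RR.1, permt sg RR.2).
pose As i := \sum_(RR <- Clist_rec I t i | ~~ in_phi (tower I t.+1) RR) W RR.
have -> : T (Csum I t) =
    \sum_(i < t.+1) ((- h) ^+ i *: Bs i + (- h) ^+ i.+1 *: As i).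
  rewrite /Csum (big_morph T TD T0); apply: eq_bigr => i _.
  rewrite TZ (big_morph T TD T0) exprSr -scalerA -scalerDr; congr (_ *: _).
  rewrite /As scaler_sumr [X in _ + X]big_mkcond -big_split big_seq [RHS]big_seq.
  apply: eq_bigr => RR /TW ->; case: in_phi; rewrite /= ?scale0r ?subr0 ?addr0 //.
  by rewrite scaleNr.
have CE i : \sum_(RR <- Clist_rec I t.+1 i) W RR =
            (if i is j.+1 then As j else 0) + Bs i.
  rewrite /= big_cat big_map; congr (_ + _).
  by case: i => [|i]; [exact: big_nil|rewrite big_filter].
rewrite /Csum; under [RHS]eq_bigr => i _ do rewrite CE scalerDr.
rewrite !big_split /= addrC; congr (_ + _).
  (* Degree 0 receives no retained pairs, hence the shift of the index by one. *)
  by rewrite [RHS]big_ord_recl scaler0 add0r.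
(* The extra top degree has no transposed pairs, the list at level [t] being empty there. *)
rewrite [RHS]big_ord_recr /=; have -> : Bs t.+1 = 0.
  by rewrite /Bs Clist_rec_out // big_nil.
by rewrite scaler0 addr0.
Qed.
End Recursion.

End TowerFacts.

(** * Exchange of the two minors along the tower *)

Section Exchange.
Variables (kq : comUnitRingType) (q : kq) (r s : nat).
Hypothesis uq : q \is a GRing.unit.
Local Notation n := (r + s)%N.
Let A : algType kq := qmx q n.
Implicit Types (I J : r.-tuple 'I_n).

Definition word_minors (RR : r.-tuple 'I_n * s.-tuple 'I_n) : A :=
  qminor q (first_idx r s) RR.1 * qminor q (last_idx r s) RR.2.

(** As [z] is absent, the transposition can only lower an entry [zz] to the free value just
    below. *)
Lemma increasing_adj p (z zz : 'I_n) (S : p.-tuple 'I_n) :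
  zz = z.+1 :> nat -> z \notin S -> increasing S ->
  increasing (map_tuple (tperm z zz) S).
Proof.
move=> zzE zS; rewrite /increasing /= sorted_map.
apply: (sub_in_sorted (P := mem S)); last exact/allP.
move=> i j iS jS /=; rewrite tperm_adj_ltn // negb_and.
  by rewrite (contraNneq _ zS) // => <-.
by rewrite orbC (contraNneq _ zS) // => <-.
Qed.

(** The base of the induction: the two blocks of the matrix lie on its antidiagonal. *)
Lemma minors_commute :
  qminor q (last_idx r s) (top_compl r s) *
    qminor q (first_idx r s) (top_cols r s) =
  qminor q (first_idx r s) (top_cols r s) *
    qminor q (last_idx r s) (top_compl r s) :> A.
Proof.
apply: commr_qminor => //.
- exact: uniq_top_cols.
- exact/increasing_uniq/increasing_top_compl.
- move=> i j /tnthP[i' ->] /tnthP[j' ->]; rewrite !tnth_mktuple /=.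
  by have := ltn_ord i'; lia.
- by move=> i j; rewrite mem_top_cols mem_top_compl; lia.
Qed.

(** Induction down from the top of the tower: the same Hecke operator carries each side at level [t]
    to that side at level [t.+1]. *)
Lemma minors_exchange I t (J' : s.-tuple 'I_n) : increasing I -> (t <= intc I)%N ->
  increasing J' -> (forall j, (j \in J') = (j \notin tower I t)) ->
  qminor q (last_idx r s) J' * qminor q (first_idx r s) (tower I t) =
  Csum (q^-1 - q) word_minors I t :> A.
Proof.
move=> incI; elim: t J' => [|t IHt] J' tN incJ' complJ'.
  have topE : tower I 0 = top_cols r s by rewrite /tower subn0 iter_intc.
  have -> : J' = top_compl r s.
    apply: increasing_eq => //; first exact: increasing_top_compl.
    by move=> j; rewrite complJ' topE mem_top_cols mem_top_compl ltnNge.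
  rewrite topE /Csum big_ord1 expr0 scale1r /= big_seq1.
  exact: minors_commute.
set J := tower I t.+1 in complJ' *.
have incJ : increasing J by apply: iter_std_step_increasing => //; exact: leq_subr.
have Jtop : J != top_cols r s by apply: iter_std_step_neq_top => //; lia.
have [z Ez [zJ zzJ zzE]] := std_entry_adj incJ Jtop.
set zz := ordS z in zzJ zzE.
have sgE : std_perm J = tperm z zz by rewrite /std_perm Ez.
(* The complement of the preceding term of the tower, to which the induction hypothesis applies. *)
set J1' := map_tuple (tperm z zz) J'.
have zJ' : z \notin J' by rewrite complJ' zJ.
have zzJ' : zz \in J' by rewrite complJ'.
have J1E : tower I t = map_tuple (tperm z zz) J.
  by rewrite -std_step_tower // /std_step sgE; exact: val_inj.
have mem_sg p (S : p.-tuple 'I_n) j :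
    (j \in map_tuple (tperm z zz) S) = (tperm z zz j \in S).
  by rewrite -{1}(tpermK z zz j) mem_map //; exact: perm_inj.
have sgsg p (S : p.-tuple 'I_n) :
    map_tuple (tperm z zz) (map_tuple (tperm z zz) S) = S.
  by apply: val_inj; rewrite /= -map_comp map_id_in // => j _ /=; rewrite tpermK.
have [T [TD TZ TM]] := hecke_qmx uq zzE.
have IH : qminor q (last_idx r s) J1' * qminor q (first_idx r s) (tower I t) =
          Csum (q^-1 - q) word_minors I t :> A.
  apply: IHt; [exact: ltnW|exact: increasing_adj|].
  by move=> j; rewrite J1E !mem_sg complJ'.
rewrite -(Csum_rec TD TZ) => [|i RR /Clist_rec_word[uR mR]]; last first.
  rewrite -/J sgE /in_phi Ez.
  exact: (TM _ _ _ _ _ _ uR (mR z) (mR zz)).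
rewrite -IH J1E.
have incJ1 : increasing (map_tuple (tperm z zz) J).
  by rewrite -J1E; apply: iter_std_step_increasing => //; exact: leq_subr.
have incJ1' : increasing J1' by exact: increasing_adj.
have uw : uniq (J1' ++ map_tuple (tperm z zz) J).
  rewrite cat_uniq (increasing_uniq incJ1) (increasing_uniq incJ1') andbT.
  apply/hasPn => j; rewrite mem_sg => jJ.
  by apply/negP => /=; rewrite mem_sg complJ' jJ.
have zw : z \in J1' by rewrite mem_sg tpermL.
have zzw : zz \notin J1' by rewrite mem_sg tpermR.
have zzw2 : zz \in map_tuple (tperm z zz) J by rewrite mem_sg tpermR.
(* The reversed product has [z] in its left factor and [zz] in its right one, so no correction term
   appears. *)
have before : (index z (J1' ++ map_tuple (tperm z zz) J)
               < index zz (J1' ++ map_tuple (tperm z zz) J))%N.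
  by rewrite !index_cat zw (negbTE zzw) ltn_addr // index_mem.
have zw' : z \in J1' ++ map_tuple (tperm z zz) J by rewrite mem_cat zw.
have zzw' : zz \in J1' ++ map_tuple (tperm z zz) J by rewrite mem_cat zzw2 orbT.
apply: (etrans _ (esym (TM _ _ (last_idx r s) J1' (first_idx r s) _ uw zw' zzw'))).
(* A second application of the transposition restores [J'] and [J]. *)
by rewrite before scale0r subr0 !sgsg.
Qed.
End Exchange.

Theorem mainTheorem1 (k : fieldType) (r s : nat)
    (I : r.-tuple 'I_(r + s)) (I' : s.-tuple 'I_(r + s))
    (incI : increasing I) (incI' : increasing I')
    (complI : forall j : 'I_(r + s), (j \in I') = (j \notin I)) :
  let q : laurent k := qvar in
  qminor q (last_idx r s) I' * qminor q (first_idx r s) I =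
  \sum_(i < (intc I).+1)
    ((-1) ^+ i * (q^-1 - q) ^+ i) *:
      \sum_(RR <- Clist I i)
        qminor q (first_idx r s) RR.1 * qminor q (last_idx r s) RR.2.
Proof.
move=> q; have IE : tower I (intc I) = I by rewrite /tower subnn.
have complE j : (j \in I') = (j \notin tower I (intc I)) by rewrite IE.
have H := minors_exchange (qvar_unit k) incI (leqnn _) incI' complE.
by rewrite IE in H; exact: (etrans H (Csum_intc _ _ _)).
Qed.
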